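(* Let $D_0\in(0,\pi)$ be given, let $\mathcal R_0:=\frac{\sin D_0}{D_0}$, and consider the system $$m_i\ddot\theta_i+d_i\dot\theta_i=\Omega_i+\sum_{j=1}^N a_{ij}\sin(\theta_j-\theta_i),\quad i=1,\dots,N,\ t>0,\qquad \sum_{i=1}^N\Omega_i=0,\quad a_{ij}=a_{ji},$$ with initial data $\theta_i(0)$, $\omega_i(0)=\dot\theta_i(0)$. With the constants defined in the context, suppose that: (H1) the graph $\mathcal G$ induced by $(a_{ij})$ is connected; (H2) $a_u^2N^2(2m_u+\lambda)<d_\ell^2(2\mathcal R_0a_\ell L_*N-\lambda)$; (H3) for some $\varepsilon\in\left(\frac{a_u^2N^2}{d_\ell(2\mathcal R_0a_\ell L_*N-\lambda)},\ \frac{d_\ell}{2m_u+\lambda}\right)$ the parameters and initial data satisfy $$\max\left\{\sqrt{\widetilde{\mathcal E}(0)},\ \frac{2\sqrt2\,C_1\max\{\varepsilon,1\}\,\|\Omega\|}{\widetilde C_\ell\sqrt{C_0}}\right\}<\frac{\sqrt{C_0}}{2}D_0,$$ where $$C_0:=\min\left\{\tfrac{m_\ell}{2},\ \varepsilon d_\ell\left(1-2\varepsilon\tfrac{m_u}{d_\ell}\right)\right\},\qquad C_1:=\max\left\{\tfrac{3m_u}{2},\ \varepsilon d_u\left(1+2\varepsilon\tfrac{m_u}{d_\ell}\right)\right\},$$ $$\widetilde C_\ell:=\min\left\{d_\ell-2\varepsilon m_u,\ 2\varepsilon\mathcal R_0a_\ell L_*N-\tfrac{a_u^2N^2}{d_\ell}\right\}-\varepsilon\lambda,$$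 $$\widetilde{\mathcal E}(0):=\varepsilon\sum_{i=1}^Nd_i(\theta_i(0)-\theta_c(0))^2+2\varepsilon\sum_{i=1}^Nm_i(\theta_i(0)-\theta_c(0))\,\omega_i(0)+\sum_{i=1}^Nm_i\omega_i^2(0),\qquad \theta_c(0):=\frac1N\sum_{i=1}^N\theta_i(0).$$ Then the global solution $\theta(t)=(\theta_1(t),\dots,\theta_N(t))\in\mathbb R^N$ of the system asymptotically exhibits a phase-locked state, i.e. for all $i\neq j$ there is a constant $\theta_{ij}\in\mathbb R$ with $\lim_{t\to\infty}(\theta_i(t)-\theta_j(t))=\theta_{ij}$.
   Context: Phases $\theta_i$ take values in $\mathbb R$ (the system is considered on $\mathbb R^N$). Parameters: $m_i>0$, $d_i>0$, $\Omega_i\in\mathbb R$, $a_{ij}\ge 0$; $\Omega=(\Omega_1,\dots,\Omega_N)$ and $\|\cdot\|$ is the Euclidean norm on $\mathbb R^N$. Graph: $\mathcal G=(\mathcal V,\mathcal W)$ with $\mathcal V=\{1,\dots,N\}$ and $\mathcal W=\{(i,j)\in\mathcal V\times\mathcal V: a_{ij}>0\}$ (symmetric since $a_{ij}=a_{ji}$). $\mathcal G$ is connected if for any $i,j\in\mathcal V$ there is a shortest path $i=p_1\to p_2\to\cdots\to p_{d_{ij}}=j$ with $(p_k,p_{k+1})\in\mathcal W$ for $k=1,\dots,d_{ij}-1$; this defines $d_{ij}$. Put $d(\mathcal G):=\max_{1\le i,j\le N}d_{ij}$, and $$L_*:=\frac{1}{1+d(\mathcal G)\,|\mathcal W^c|},$$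 where $\mathcal W^c$ is the complement of $\mathcal W$ in $\mathcal V\times\mathcal V$ and $|\mathcal W^c|$ its cardinality. Extremal parameters: $a_u:=\max\{a_{ij}:(j,i)\in\mathcal W\}$, $a_\ell:=\min\{a_{ij}:(j,i)\in\mathcal W\}$, $d_u:=\max_i d_i$, $d_\ell:=\min_i d_i$, $m_u:=\max_i m_i$, $m_\ell:=\min_i m_i$. Fluctuations: $\hat d_i:=d_i-\frac1N\sum_{k=1}^Nd_k$, $\hat m_i:=m_i-\frac1N\sum_{k=1}^Nm_k$, $\hat D:=\mathrm{diag}(\hat d_1,\dots,\hat d_N)$, $\hat M:=\mathrm{diag}(\hat m_1,\dots,\hat m_N)$, and $$\lambda:=\frac{\sqrt{\mathrm{tr}(\hat D^2)}}{\sqrt N}+\frac{2\sqrt{\mathrm{tr}(\hat M^2)}}{\sqrt N}.$$ *)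

(* Defs.v *)
From HB Require Import structures.
From mathcomp Require Import all_boot all_order all_algebra.
From mathcomp Require Import all_classical all_reals all_analysis.
Set Implicit Arguments.
Unset Strict Implicit.
Unset Printing Implicit Defensive.
Import Order.TTheory GRing.Theory Num.Theory.
Import numFieldNormedType.Exports.

Local Open Scope classical_set_scope.
Local Open Scope ring_scope.

(* Here [theta i t] is the phase of oscillator [i] at time [t] and [omega i t]
   its velocity. Only the values for [0 <= t] are constrained: right-continuity
   of phases and velocities at [0] attaches the initial data
   [theta i 0], [omega i 0] to the trajectory and, with the equations for
   [0 < t], makes [omega i 0] the right derivative of [theta i] at [0]. *)
Definition kuramoto_solution (R : realType) (N : nat) (m d Omega : 'I_N -> R)
    (a : 'M[R]_N) (theta omega : 'I_N -> R -> R) : Prop :=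
  (forall i, {within `[0, +oo[, continuous (theta i)} /\
             {within `[0, +oo[, continuous (omega i)}) /\
  (forall i (t : R), 0 < t ->
     [/\ derivable (theta i) t 1, derive1 (theta i) t = omega i t,
         derivable (omega i) t 1 &
         m i * derive1 (omega i) t + d i * derive1 (theta i) t =
         Omega i + \sum_j a i j * sin (theta j t - theta i t)]).

Definition edges (R : realType) (N : nat) (a : 'M[R]_N) : {set 'I_N * 'I_N} :=
  [set p : 'I_N * 'I_N | 0 < a p.1 p.2]%SET.

Definition adj (R : realType) (N : nat) (a : 'M[R]_N) : rel 'I_N :=
  fun i j => (i, j) \in edges a.

Definition graph_connected (R : realType) (N : nat) (a : 'M[R]_N) : Prop :=
  forall i j, connect (adj a) i j.

(* A path [i = p_1 -> ... -> p_(k+1) = j], i.e. [k] edges and [k.+1] vertices. *)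
Definition has_path (R : realType) (N : nat) (a : 'M[R]_N) (i j : 'I_N)
    (k : nat) : bool :=
  [exists p : k.-tuple 'I_N, path (adj a) i p && (last i p == j)].

(* The number of vertices (not of edges) of a shortest path
   [i = p_1 -> ... -> p_(d_ij) = j]; in particular it is 1 when [i = j].
   A shortest path is simple, so it has fewer than [N] edges. *)
Definition path_dist (R : realType) (N : nat) (a : 'M[R]_N) (i j : 'I_N) : nat :=
  (find (has_path a i j) (iota 0 N)).+1.

Definition diam (R : realType) (N : nat) (a : 'M[R]_N) : nat :=
  (\max_i \max_j path_dist a i j)%N.

Definition L_star (R : realType) (N : nat) (a : 'M[R]_N) : R :=
  (1 + (diam a * #|~: edges a|)%:R)^-1.

(* Extremal values. The neutral elements do not affect the results: all the
   values are nonnegative, and a minimum is at most the maximum of the same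
   nonempty family. (If [edges a] is empty, both [a_u] and [a_l] are 0.) *)
Definition max_param (R : realType) (N : nat) (x : 'I_N -> R) : R :=
  \big[Num.max/0]_i x i.

Definition min_param (R : realType) (N : nat) (x : 'I_N -> R) : R :=
  \big[Num.min/max_param x]_i x i.

Definition a_u (R : realType) (N : nat) (a : 'M[R]_N) : R :=
  \big[Num.max/0]_(p in edges a) a p.2 p.1.

Definition a_l (R : realType) (N : nat) (a : 'M[R]_N) : R :=
  \big[Num.min/a_u a]_(p in edges a) a p.2 p.1.

Definition mean (R : realType) (N : nat) (x : 'I_N -> R) : R :=
  N%:R^-1 * \sum_k x k.

Definition fluct_mx (R : realType) (N : nat) (x : 'I_N -> R) : 'M[R]_N :=
  diag_mx (\row_i (x i - mean x)).

Definition lambda (R : realType) (N : nat) (m d : 'I_N -> R) : R :=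
  Num.sqrt (\tr (fluct_mx d *m fluct_mx d)) / Num.sqrt N%:R +
  2 * Num.sqrt (\tr (fluct_mx m *m fluct_mx m)) / Num.sqrt N%:R.

(* The library norm on row vectors is the sup norm, hence this definition. *)
Definition enorm (R : realType) (N : nat) (x : 'I_N -> R) : R :=
  Num.sqrt (\sum_i x i ^+ 2).

Definition R_0 (R : realType) (D0 : R) : R := sin D0 / D0.

Definition C_0 (R : realType) (N : nat) (m d : 'I_N -> R) (eps : R) : R :=
  let m_u := max_param m in let m_l := min_param m in
  let d_l := min_param d in
  Num.min (m_l / 2) (eps * d_l * (1 - 2 * eps * (m_u / d_l))).

Definition C_1 (R : realType) (N : nat) (m d : 'I_N -> R) (eps : R) : R :=
  let m_u := max_param m in
  let d_u := max_param d in let d_l := min_param d in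
  Num.max (3 * m_u / 2) (eps * d_u * (1 + 2 * eps * (m_u / d_l))).

Definition C_l_tilde (R : realType) (N : nat) (m d : 'I_N -> R) (a : 'M[R]_N)
    (D0 eps : R) : R :=
  let m_u := max_param m in let d_l := min_param d in
  Num.min (d_l - 2 * eps * m_u)
          (2 * eps * R_0 D0 * a_l a * L_star a * N%:R
             - a_u a ^+ 2 * N%:R ^+ 2 / d_l)
  - eps * lambda m d.

Definition energy0 (R : realType) (N : nat) (m d : 'I_N -> R) (eps : R)
    (theta0 omega0 : 'I_N -> R) : R :=
  let theta_c := mean theta0 in
  eps * (\sum_i d i * (theta0 i - theta_c) ^+ 2) +
  2 * eps * (\sum_i m i * (theta0 i - theta_c) * omega0 i) +
  \sum_i m i * omega0 i ^+ 2.

Definition phase_locked (R : realType) (N : nat) (theta : 'I_N -> R -> R) : Prop :=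
  forall i j : 'I_N, i != j ->
    exists theta_ij : R, theta i t - theta j t @[t --> +oo] --> theta_ij.

(* Main.v *)
Require Import Defs.
From mathcomp Require Import all_boot all_order all_algebra.
From mathcomp Require Import all_classical all_reals all_analysis.
From mathcomp Require Import ring lra.
Import Order.TTheory GRing.Theory Num.Theory.
Import numFieldNormedType.Exports.

(** Two Lyapunov functions are used, one after the other: the first confines the
    trajectory, the second makes it converge.

    Confinement. Write [y] for the phases minus their mean, [w] for the
    velocities and [X = |y|^2 + |w|^2]. Completing squares gives
    [C_0 X <= E <= C_1 X] for [E], the quantity [energy0] taken at time [t]
    ([C_0_le_energy], [energy_le_C_1]). As long as all phase differences are at
    most [D0 < pi], the chord bound [x sin x >= (sin D0 / D0) x^2] and a
    Poincare inequality on the connected graph ([graph_poincare], whose constant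
    is [L_star]) make the coupling push the phases together, and
    [E' <= - C_l_tilde X + 2 (eps |y| + |w|) |Omega|] ([energy_dissipation]).
    At the level [E = C_0 (D0 / 2)^2] the phase differences are indeed at most
    [D0], and the assumption on [|Omega|] says that [E' < 0] there
    ([energy_rate_lt0]); so this level is never reached ([energy_trapping]),
    and [|y|, |w| <= D0 / 2] for all times.

    Convergence. The mechanical energy has derivative [- sum_i d_i w_i^2] and is
    bounded below on the confined region, so it converges. Barbalat's lemma,
    applied to it and then to the velocities, shows that velocities and
    accelerations vanish at infinity, hence so does the net force
    [Omega_i + sum_j a_ij sin (theta_j - theta_i)] ([velocity_cvg0],
    [net_force_cvg0]). It remains to see that a small force determines the phase
    differences. The assumption on [|Omega|] is strong enough to give
    [6 |Omega| <= G D0], where [G] is the stiffness of the coupling on the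
    region of spread [D0]; therefore a state with small force has
    [|y| <= D0 / 4], hence spread at most [D0 / 2 < pi / 2]
    ([fluct_le_force]). There [sin] is strictly increasing, the force field is
    strongly monotone modulo rotations ([fluct_dist_le_force]), and comparing
    the states at two late times shows that the phase differences are Cauchy. *)

Set Implicit Arguments.
Unset Strict Implicit.
Unset Printing Implicit Defensive.
Local Open Scope classical_set_scope.
Local Open Scope ring_scope.

(** * Inequalities for the sine *)

Lemma mean_value (R : realType) (f df : R -> R) (x y : R) : x < y ->
  (forall z, x <= z <= y -> is_derive z 1 f (df z)) ->
  exists2 c, x < c < y & f y - f x = df c * (y - x).
Proof.
move=> xy dfE.
have [||c] := @MVT R f df x y xy.
- by move=> z /andP[]; rewrite !bnd_simp => xz zy; apply: dfE; rewrite !ltW.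
- apply: derivable_within_continuous => z; rewrite in_itv/= => /dfE dz.
  exact: ex_derive.
- by rewrite in_itv/=; exists c.
Qed.

(** By concavity the graph of [sin] lies above its chord on [[0, D]]: a point
    below the chord would force [cos c1 < cos c2] at mean-value points
    [c1 < c2], whereas [cos] decreases on [[0, pi]]. *)
Lemma sin_chord_ge0 (R : realType) (D x : R) : 0 <= x -> x <= D -> D < pi ->
  sin D / D * x <= sin x.
Proof.
move=> x0 xD Dpi.
have [->|x_neq0] := eqVneq x 0; first by rewrite mulr0 sin0.
have [->|xD_neq] := eqVneq x D.
  by rewrite divfK// -?xD_neq//; apply: contraNneq x_neq0; lra.
have x_gt0 : 0 < x by lra.
have {}xD : x < D by lra.
rewrite leNgt; apply/negP => lt_sin.
have [|c1 c1x sin_x] := @mean_value _ (@sin R) cos 0 x => //.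
have [|c2 c2x sin_D] := @mean_value _ (@sin R) cos x D => //.
have : cos c2 < cos c1.
  by rewrite ltr_cos ?in_itv/=; [lra | lra | lra].
set k := sin D / D in lt_sin.
have sinDE : sin D = k * D by rewrite /k divfK//; lra.
apply/negP; rewrite -leNgt.
have c1k : cos c1 < k.
  by rewrite -(ltr_pM2r x_gt0) (le_lt_trans _ lt_sin)//; move: sin_x; rewrite sin0; lra.
have c2k : k < cos c2.
  have Dx : 0 < D - x by lra.
  by rewrite -(ltr_pM2r Dx); move: sin_D; rewrite sinDE; lra.
lra.
Qed.

(** The chord slope [sin D / D] is a lower bound by concavity of [sin] on [[0, pi]]. *)
Lemma sin_chord (R : realType) (D x : R) : `|x| <= D -> D < pi ->
  sin D / D * x ^+ 2 <= x * sin x.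
Proof.
move=> xD Dpi; have [x0|x0] := leP 0 x.
  rewrite expr2 mulrA mulrC ler_wpM2l// sin_chord_ge0//.
  by rewrite ger0_norm in xD.
have := @sin_chord_ge0 _ D (- x); rewrite sinN ltr0_norm// in xD *.
by move=> /(_ _ xD Dpi); nra.
Qed.

Lemma sin_lipschitz (R : realType) (x : R) : `|sin x| <= `|x|.
Proof.
wlog x0 : x / 0 < x.
  move=> H; have [x0|x0|<-] := ltgtP 0 x; [exact: H| |by rewrite sin0].
  by rewrite -normrN -sinN -(normrN x) H// oppr_gt0.
have [|c _] := @mean_value _ (@sin R) cos 0 x => //.
rewrite sin0 !subr0 => ->; rewrite normrM ler_piMl//.
by rewrite ler_norml cos_geN1 cos_le1.
Qed.

Lemma sin_strong_monotone (R : realType) (D x y : R) : D <= pi ->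
  `|x| <= D -> `|y| <= D -> cos D * (x - y) ^+ 2 <= (sin x - sin y) * (x - y).
Proof.
move=> Dpi.
wlog xy : x y / y < x.
  move=> H; have [xy|xy|->] := ltgtP y x; [exact: H| |by rewrite !subrr; lra].
  by move=> xD yD; have := H y x xy yD xD; nra.
move=> xD yD.
have [|c cyx ->] := @mean_value _ (@sin R) cos y x => //.
rewrite -mulrA -expr2 ler_wpM2r ?sqr_ge0// -[cos c](cos_norm).
move: xD yD; rewrite !ler_norml => /andP[x1 x2] /andP[y1 y2].
have cD : `|c| <= D by rewrite ler_norml; lra.
have D0 : 0 <= `|c| := normr_ge0 c.
by rewrite leNgt ltr_cos ?in_itv/=; lra.
Qed.

(** * Euclidean norms and fluctuations *)

Definition fluct (R : realType) (N : nat) (x : 'I_N -> R) (i : 'I_N) : R :=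
  x i - mean x.

Definition sqnorm (R : realType) (N : nat) (x : 'I_N -> R) : R :=
  \sum_i x i ^+ 2.

Lemma sqnorm_ge0 (R : realType) (N : nat) (x : 'I_N -> R) : 0 <= sqnorm x.
Proof. by apply: sumr_ge0 => i _; rewrite sqr_ge0. Qed.

Lemma enorm_ge0 (R : realType) (N : nat) (x : 'I_N -> R) : 0 <= enorm x.
Proof. exact: sqrtr_ge0. Qed.

Lemma enorm_sqr (R : realType) (N : nat) (x : 'I_N -> R) :
  enorm x ^+ 2 = sqnorm x.
Proof. by rewrite sqr_sqrtr// sqnorm_ge0. Qed.

Lemma enorm_le (R : realType) (N : nat) (x : 'I_N -> R) (B : R) :
  0 <= B -> sqnorm x <= B ^+ 2 -> enorm x <= B.
Proof. by move=> B0; rewrite -enorm_sqr ler_pXn2r// nnegrE// enorm_ge0. Qed.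

Lemma cauchy_schwarz (R : realType) (I : finType) (x y : I -> R) :
  (\sum_i x i * y i) ^+ 2 <= (\sum_i x i ^+ 2) * \sum_i y i ^+ 2.
Proof.
have : 0 <= \sum_i \sum_j (x i * y j - x j * y i) ^+ 2.
  by do 2![apply: sumr_ge0 => ? _]; rewrite sqr_ge0.
have -> : \sum_i \sum_j (x i * y j - x j * y i) ^+ 2 =
    2 * ((\sum_i x i ^+ 2) * \sum_i y i ^+ 2) - 2 * (\sum_i x i * y i) ^+ 2.
  rewrite [2 * _]mulr_natl mulr2n [X in _ + X - _]mulrC expr2 !big_distrlr/=.
  rewrite mulr_sumr -big_split/= -sumrB; apply: eq_bigr => i _.
  by rewrite mulr_sumr -big_split/= -sumrB; apply: eq_bigr => j _; ring.
by move=> ?; lra.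
Qed.

Lemma enorm_cauchy_schwarz (R : realType) (N : nat) (x y : 'I_N -> R) :
  `|\sum_i x i * y i| <= enorm x * enorm y.
Proof.
rewrite -(ler_pXn2r (n := 2))// ?nnegrE ?mulr_ge0 ?enorm_ge0//.
by rewrite exprMn !enorm_sqr -normrX ger0_norm ?sqr_ge0// cauchy_schwarz.
Qed.

Lemma normr_le_enorm (R : realType) (N : nat) (x : 'I_N -> R) i :
  `|x i| <= enorm x.
Proof.
rewrite -(ler_pXn2r (n := 2))// ?nnegrE ?enorm_ge0// enorm_sqr.
rewrite -normrX ger0_norm ?sqr_ge0// /sqnorm (bigD1 i)//= lerDl.
by apply: sumr_ge0 => j _; rewrite sqr_ge0.
Qed.

Lemma sum_fluct (R : realType) (N : nat) (x : 'I_N -> R) :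
  \sum_i fluct x i = 0.
Proof.
case: N x => [|n] x; first by rewrite big_ord0.
by rewrite sumrB sumr_const card_ord -mulr_natl /mean mulrA divff ?mul1r ?subrr//.
Qed.

Lemma fluctB (R : realType) (N : nat) (x : 'I_N -> R) i j :
  fluct x i - fluct x j = x i - x j.
Proof. by rewrite /fluct; ring. Qed.

Lemma dist_le_enorm_fluct (R : realType) (N : nat) (x : 'I_N -> R) i j :
  `|x i - x j| <= 2 * enorm (fluct x).
Proof.
rewrite -fluctB (le_trans (ler_normB _ _))//.
by rewrite mulr_natl mulr2n lerD ?normr_le_enorm.
Qed.

Lemma sqnorm_fluct (R : realType) (N : nat) (x : 'I_N -> R) :
  \sum_i \sum_j (x i - x j) ^+ 2 = 2 * N%:R * sqnorm (fluct x).
Proof.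
transitivity (\sum_i \sum_j (fluct x i ^+ 2 + fluct x j ^+ 2
   - 2 * fluct x i * fluct x j)).
  by apply: eq_bigr => i _; apply: eq_bigr => j _; rewrite -fluctB; ring.
have cross0 i : \sum_j 2 * fluct x i * fluct x j = 0.
  by rewrite -mulr_sumr sum_fluct mulr0.
under eq_bigr do rewrite sumrB big_split/= cross0 subr0 sumr_const card_ord.
rewrite big_split/= sumr_const card_ord -/(sqnorm _) sumrMnl -/(sqnorm _).
by rewrite -mulr_natl; ring.
Qed.

(** Action and reaction: symmetrizing a double sum over ordered pairs. *)
Lemma sum_antisym (R : realType) (N : nat) (h : 'I_N -> 'I_N -> R)
    (y : 'I_N -> R) : (forall i j, h j i = - h i j) ->
  2 * \sum_i y i * (\sum_j h i j) = \sum_i \sum_j h i j * (y i - y j).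
Proof.
move=> hN.
under [RHS]eq_bigr do under eq_bigr do rewrite mulrBr.
under [RHS]eq_bigr do rewrite sumrB.
rewrite sumrB [X in _ - X]exchange_big/=.
under [X in _ - X]eq_bigr do under eq_bigr do rewrite hN mulNr.
under [X in _ - X]eq_bigr do rewrite sumrN.
rewrite sumrN opprK mulr_natl mulr2n.
by congr (_ + _); apply: eq_bigr => i _; rewrite mulr_sumr;
  apply: eq_bigr => j _; rewrite mulrC.
Qed.

(** * Poincare inequality on the graph *)

(** Each edge of the path is charged to its origin [u], together with all other
    edges at [u]. On a simple path the origins are distinct, so that no edge is
    charged twice. *)
Lemma path_sqr_le (R : realType) (V : finType) (e : rel V) (x : V -> R)
    (i : V) (p : seq V) : path e i p ->
  (x i - x (last i p)) ^+ 2 <=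
    (size p)%:R * \sum_(u <- belast i p) \sum_(v | e u v) (x u - x v) ^+ 2.
Proof.
elim: p i => [|k p IH] i /=; first by rewrite subrr expr0n mul0r.
move=> /andP[eik /IH]; rewrite big_cons -natr1.
set s := \sum_(u <- _) _; set n := (size p)%:R => le_s.
have le_i : (x i - x k) ^+ 2 <= \sum_(v | e i v) (x i - x v) ^+ 2.
  by rewrite (bigD1 k)//= lerDl sumr_ge0// => v _; rewrite sqr_ge0.
set b := \sum_(v | _) _ in le_i *.
have n0 : 0 <= n by rewrite ler0n.
have s0 : 0 <= s.
  by rewrite sumr_ge0// => u _; rewrite sumr_ge0// => v _; rewrite sqr_ge0.
have [n_eq0|n_neq0] := eqVneq n 0.
  move: le_s; rewrite n_eq0 mul0r add0r mul1r => le_w.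
  have /eqP : (x k - x (last k p)) ^+ 2 == 0 by rewrite eq_le le_w sqr_ge0.
  by move=> /eqP; rewrite sqrf_eq0 subr_eq0 => /eqP <-; lra.
have n_gt0 : 0 < n by lra.
rewrite -(ler_pM2l n_gt0).
set u := x i - x k in le_i; set w := x k - _ in le_s.
have -> : x i - x (last k p) = u + w by rewrite /u /w; ring.
(* Cauchy-Schwarz for the new edge, of weight 1, and the rest, of weight [n]. *)
have : 0 <= (n * u - w) ^+ 2 by rewrite sqr_ge0.
have : 0 <= n * (n + 1) * (b - u ^+ 2).
  by rewrite !mulr_ge0 ?subr_ge0//; lra.
have : 0 <= (n + 1) * (n * s - w ^+ 2).
  by rewrite mulr_ge0 ?subr_ge0//; lra.
lra.
Qed.

(** [path_dist] counts vertices, hence bounds the number of edges with one to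
    spare. Removing the loops of a path makes it simple without lengthening it. *)
Lemma path_dist_path (R : realType) (N : nat) (a : 'M[R]_N) i j :
  connect (adj a) i j ->
  exists p, [/\ path (adj a) i p, uniq (i :: p), last i p = j &
                (size p <= path_dist a i j)%N].
Proof.
move=> /connectP[p ap pj].
have has_p : has (has_path a i j) (iota 0 N).
  move: pj; case/shortenP: ap => q aq uq _ qj; apply/hasP; exists (size q).
    rewrite mem_iota/= add0n -[N in (_ < N)%N]card_ord.
    by rewrite -[(size q).+1]/(size (i :: q)) -(card_uniqP uq) max_card.
  by apply/existsP; exists (in_tuple q); rewrite aq qj/=.
have lt_find := has_p; rewrite has_find size_iota in lt_find.
have /existsP[q /andP[aq /eqP qj]] := nth_find 0%N has_p.
have le_q : (size q <= path_dist a i j)%N.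
  by rewrite (size_tuple q) nth_iota// add0n leqnSn.
move: qj; case/shortenP: aq => r ar ur sub_r rj.
exists r; split=> //; apply: leq_trans le_q; apply: uniq_leq_size => //.
by case/andP: ur.
Qed.

Lemma path_dist_le_diam (R : realType) (N : nat) (a : 'M[R]_N) i j :
  (path_dist a i j <= diam a)%N.
Proof.
by rewrite /diam (bigD1 i)//= leq_max (bigD1 j)//= leq_max leqnn.
Qed.

Lemma connected_sqr_le (R : realType) (N : nat) (a : 'M[R]_N) (x : 'I_N -> R) i j :
  graph_connected a ->
  (x i - x j) ^+ 2 <=
    (diam a)%:R * \sum_(p in edges a) (x p.1 - x p.2) ^+ 2.
Proof.
move=> /(_ i j)/path_dist_path[p [ap up pj le_p]].
have -> : \sum_(p in edges a) (x p.1 - x p.2) ^+ 2 =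
   \sum_u \sum_(v | adj a u v) (x u - x v) ^+ 2.
  by rewrite pair_big_dep/=; apply: eq_bigl => -[u v].
rewrite -pj (le_trans (path_sqr_le x ap))// ler_pM ?ler0n//.
- by rewrite sumr_ge0// => u _; rewrite sumr_ge0// => v _; rewrite sqr_ge0.
- by rewrite ler_nat (leq_trans le_p)// path_dist_le_diam.
rewrite big_uniq/=; last first.
  by move: up; rewrite lastI rcons_uniq => /andP[].
rewrite [leRHS](bigID (mem (belast i p)))/= lerDl.
by rewrite sumr_ge0// => u _; rewrite sumr_ge0// => v _; rewrite sqr_ge0.
Qed.

Lemma L_star_gt0 (R : realType) (N : nat) (a : 'M[R]_N) : 0 < L_star a.
Proof. by rewrite invr_gt0 ltr_wpDr// ler0n. Qed.

(** Pairs that are not edges are compared with the edge sum along a path; there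
    are at most [#|~: edges a|] of them, and each costs at most the diameter. *)
Lemma graph_poincare (R : realType) (N : nat) (a : 'M[R]_N) (x : 'I_N -> R) :
  graph_connected a ->
  L_star a * \sum_i \sum_j (x i - x j) ^+ 2 <=
    \sum_(p in edges a) (x p.1 - x p.2) ^+ 2.
Proof.
move=> conn; rewrite pair_big/= (bigID (mem (edges a)))/=.
set S := \sum_(p in edges a) _.
rewrite /L_star mulrC ler_pdivrMr ?ltr_wpDr ?ler0n// mulrDr mulr1 lerD2l.
rewrite natrM mulrA [S * _]mulrC mulr_natr -sumr_const.
rewrite [leRHS](eq_bigl (fun p => p \notin edges a)); last by move=> p; rewrite inE.
by apply: ler_sum => p _; exact: connected_sqr_le.
Qed.

Lemma a_u_ge0 (R : realType) (N : nat) (a : 'M[R]_N) : 0 <= a_u a.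
Proof. by rewrite /a_u; elim/big_rec: _ => // p y _ y0; rewrite le_max y0 orbT. Qed.

Lemma le_a_u (R : realType) (N : nat) (a : 'M[R]_N) i j :
  (forall i j, a i j = a j i) -> a i j <= a_u a.
Proof.
move=> a_sym; have [aij|aij] := ltP 0 (a i j); last exact: le_trans (a_u_ge0 a).
rewrite /a_u a_sym.
by apply: (@le_bigmax_cond _ _ _ 0 (i, j) _ (fun p => a p.2 p.1)); rewrite inE.
Qed.

Lemma a_l_le (R : realType) (N : nat) (a : 'M[R]_N) (p : 'I_N * 'I_N) :
  p \in edges a -> a_l a <= a p.2 p.1.
Proof. by move=> pa; rewrite /a_l; apply: bigmin_le_cond. Qed.

(** The graph inequality turns a quadratic lower bound [k] on the pair
    interaction into coercivity in the fluctuations. The factor 2 comes from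
    counting ordered pairs. *)
Lemma coupling_coercive (R : realType) (N : nat) (a : 'M[R]_N) (k : R)
    (h : 'I_N -> 'I_N -> R) (z : 'I_N -> R) :
  (forall i j, a i j = a j i) -> (forall i j, 0 <= a i j) ->
  graph_connected a -> 0 <= k -> 0 <= a_l a ->
  (forall i j, k * (z i - z j) ^+ 2 <= h i j) ->
  2 * (k * a_l a * L_star a * N%:R) * sqnorm (fluct z) <= \sum_i \sum_j a i j * h i j.
Proof.
move=> a_sym a_ge0 conn k0 al0 hk.
have -> : 2 * (k * a_l a * L_star a * N%:R) * sqnorm (fluct z) =
   k * a_l a * (L_star a * (2 * N%:R * sqnorm (fluct z))) by ring.
rewrite -sqnorm_fluct (le_trans (ler_wpM2l _ (graph_poincare _ conn)))//.
  by rewrite mulr_ge0.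
rewrite pair_big/= mulr_sumr big_mkcond/=.
apply: ler_sum => -[i j] _ /=; case: ifPn => [aij|_]; last first.
  by rewrite mulr_ge0// (le_trans _ (hk _ _))// mulr_ge0// sqr_ge0.
rewrite mulrAC [leRHS]mulrC ler_pM//.
  by rewrite mulr_ge0// sqr_ge0.
by rewrite a_sym; apply: (@a_l_le _ _ _ (i, j)).
Qed.

(** * Calculus on a half-line *)

(** Derivative rules in pointwise form, so that they unify with functions
    written as abstractions over time. *)
Lemma is_derive_addf (R : realType) (f g : R -> R) (t a b : R) :
  is_derive t 1 f a -> is_derive t 1 g b ->
  is_derive t 1 (fun s => f s + g s) (a + b).
Proof. by move=> ? ?; exact: is_deriveD. Qed.

Lemma is_derive_subf (R : realType) (f g : R -> R) (t a b : R) :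
  is_derive t 1 f a -> is_derive t 1 g b ->
  is_derive t 1 (fun s => f s - g s) (a - b).
Proof. by move=> ? ?; exact: is_deriveB. Qed.

Lemma is_derive_mulf (R : realType) (f g : R -> R) (t a b : R) :
  is_derive t 1 f a -> is_derive t 1 g b ->
  is_derive t 1 (fun s => f s * g s) (a * g t + f t * b).
Proof.
move=> fa gb; rewrite addrC [a * _]mulrC; exact: is_deriveM.
Qed.

Lemma is_derive_scalef (R : realType) (c : R) (f : R -> R) (t a : R) :
  is_derive t 1 f a -> is_derive t 1 (fun s => c * f s) (c * a).
Proof. by move=> ?; exact: is_deriveZ. Qed.

Lemma is_derive_sqrf (R : realType) (f : R -> R) (t a : R) :
  is_derive t 1 f a -> is_derive t 1 (fun s => f s ^+ 2) (2 * f t * a).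
Proof.
move=> fa; have := is_derive_mulf fa fa.
by rewrite (_ : _ + _ = 2 * f t * a)//; ring.
Qed.

Lemma is_derive_sumf (R : realType) (n : nat) (f : 'I_n -> R -> R)
    (a : 'I_n -> R) (t : R) :
  (forall i, is_derive t 1 (f i) (a i)) ->
  is_derive t 1 (fun s => \sum_i f i s) (\sum_i a i).
Proof.
move=> fa; have := is_derive_sum fa.
by rewrite (_ : \sum_i f i = fun s => \sum_i f i s)//; apply/funext => s;
  rewrite fct_sumE.
Qed.

Lemma is_derive_continuous (R : realType) (f : R -> R) (t a : R) :
  is_derive t 1 f a -> {for t, continuous f}.
Proof. by move=> [/derivable1_diffP/differentiable_continuous]. Qed.

Lemma is_derive_continuous_within (R : realType) (f df : R -> R) (a b : R) :
  (forall t, a <= t <= b -> is_derive t 1 f (df t)) ->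
  {within `[a, b], continuous f}.
Proof.
move=> fE; apply: derivable_within_continuous => z; rewrite in_itv/= => /fE dz.
exact: ex_derive.
Qed.

Lemma derive_lt0_left (R : realType) (f : R -> R) (t0 s df : R) :
  t0 < s -> is_derive s 1 f df -> df < 0 -> exists2 u, t0 < u < s & f s < f u.
Proof.
move=> t0s fs df0.
have /cvgr_lt/(_ 0) : h^-1 *: ((f \o shift s) (h *: 1) - f s) @[h --> 0^'] --> df.
  by have := @ex_derive _ _ _ _ _ _ _ fs; have <- := @derive_val _ _ _ _ _ _ _ fs.
move=> /(_ df0) /nbhs_ballP [e /= e0 fe].
pose h := Num.min (e / 2) ((s - t0) / 2).
have h0 : 0 < h by rewrite lt_min; apply/andP; split; lra.
have he : h < e by rewrite gt_min; apply/orP; left; lra.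
have hs : h < s - t0 by rewrite gt_min; apply/orP; right; lra.
exists (s - h); first by apply/andP; split; lra.
have := fe (- h); rewrite /ball/= sub0r opprK gtr0_norm// oppr_eq0 gt_eqF// =>
  /(_ he isT).
rewrite /GRing.scale/= mulr1 (addrC (- h)) invrN mulNr oppr_lt0 pmulr_rgt0 ?invr_gt0//.
by rewrite subr_gt0.
Qed.

(** At the first time the level [M] is met from below the derivative cannot be
    negative. *)
Lemma barrier (R : realType) (f df : R -> R) (t0 M : R) :
  (forall t, t0 <= t -> is_derive t 1 f (df t)) -> f t0 < M ->
  (forall t, t0 <= t -> f t = M -> df t < 0) ->
  forall t, t0 <= t -> f t < M.
Proof.
move=> fE f0 dfM t1 t01; rewrite ltNge; apply/negP => fM.
pose A := [set t | t0 <= t /\ f t = M].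
have reach b : t0 <= b -> M <= f b -> exists2 c, A c & c <= b.
  move=> t0b Mb; have [|||c] := @IVT _ f t0 b M => //.
  - by apply: (@is_derive_continuous_within _ _ df) => t /andP[+ _]; exact: fE.
  - by rewrite ge_min le_max (ltW f0) Mb orbT.
  - by rewrite in_itv/= => /andP[? ?] fc; exists c.
have [c0 Ac0 _] := reach _ t01 fM.
have lbA : lbound A t0 by move=> t [].
have infA : has_inf A by split; [exists c0 | exists t0].
pose s := inf A.
have lbs u : A u -> s <= u by move=> Au; apply: ge_inf => //; exists t0.
have t0s : t0 <= s by apply: lb_le_inf => //; exists c0.
have fs : f s = M.
  apply/eqP; apply: contraT => fsM.
  have e0 : 0 < `|f s - M| by rewrite normr_gt0 subr_eq0.
  have /cvgrPdist_lt/(_ _ e0)/nbhs_ballP[d /= d0 fd] := is_derive_continuous (fE _ t0s).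
  have [u Au us] := inf_adherent d0 infA.
  have := fd u; case: (Au) => _ ->; rewrite ltxx; apply.
  by rewrite /ball/= ler0_norm ?opprB ?subr_le0 ?lbs// ltrBlDl.
have {}t0s : t0 < s.
  by rewrite lt_neqAle t0s andbT; apply: contraTneq f0 => ->; rewrite fs ltxx.
have [u /andP[t0u us] fu] := derive_lt0_left t0s (fE _ (ltW t0s)) (dfM _ (ltW t0s) fs).
have [|c /lbs sc cu] := reach u (ltW t0u); first by rewrite -fs ltW.
lra.
Qed.

(** If [g] were still of size [e] at a late time, the bound on its derivative
    would keep it of that order on a window of fixed length [h], and [f] would
    keep moving by a fixed amount. *)
Lemma barbalat (R : realType) (f g k : R -> R) (K l : R) :
  (forall t : R, 0 < t -> is_derive t 1 f (g t)) ->
  (forall t : R, 0 < t -> is_derive t 1 g (k t)) ->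
  (forall t, 0 < t -> `|k t| <= K) ->
  f t @[t --> +oo] --> l -> g t @[t --> +oo] --> 0.
Proof.
move=> fg gk kK fl; apply/cvgrPdist_le => e e0.
have K0 : 0 <= K by apply: le_trans (kK 1 _).
(* On a window of length [h] the value of [g] varies by at most [e / 2]. *)
pose h := e / (2 * (K + 1)).
have h0 : 0 < h by rewrite divr_gt0//; lra.
have hK : K * h <= e / 2.
  have : h * (2 * (K + 1)) = e by rewrite /h divfK//; lra.
  by nra.
have d0 : 0 < e * h / 8 by rewrite divr_gt0// mulr_gt0.
move/cvgrPdist_lt/(_ _ d0) : fl => [T [_ fT]].
near=> t; have t0 : 0 < t by near: t; apply: nbhs_pinfty_gt; rewrite num_real.
have tT : T < t by near: t; apply: nbhs_pinfty_gt; rewrite num_real.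
have th : t < t + h by lra.
have [|c /andP[tc cth] fc] := @mean_value _ f g t (t + h) th.
  by move=> z /andP[tz _]; apply: fg; lra.
have [|b /andP[tb bc] gc] := @mean_value _ g k t c tc.
  by move=> z /andP[tz _]; apply: gk; lra.
have kb : `|k b| <= K by apply: kK; lra.
rewrite sub0r normrN.
have -> : g t = g c - k b * (c - t) by rewrite -gc; ring.
have gce : `|g c| * h <= e / 4 * h.
  have -> : `|g c| * h = `|f (t + h) - f t|.
    by rewrite fc normrM [`|t + h - t|]gtr0_norm; [congr (_ * _); ring | lra].
  have := fT _ tT; have := fT (t + h); rewrite /= => /(_ ltac:(lra)).
  by rewrite !ltr_norml ler_norml; lra.
rewrite ler_pM2r// in gce.
apply: (le_trans (ler_normB _ _)); rewrite normrM [`|c - t|]gtr0_norm; last lra.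
have : `|k b| * (c - t) <= K * h by apply: ler_pM => //; lra.
lra.
Unshelve. all: by end_near. Qed.

Lemma nonincreasing_bounded_cvg (R : realType) (f df : R -> R) (B : R) :
  (forall t : R, 0 < t -> is_derive t 1 f (df t)) ->
  (forall t : R, 0 < t -> df t <= 0) -> (forall t : R, 0 < t -> B <= f t) ->
  exists l : R, f t @[t --> +oo] --> l.
Proof.
move=> fE df0 fB.
have f_noninc (s t : R) : 0 < s -> s <= t -> f t <= f s.
  move=> s0; rewrite le_eqVlt => /predU1P[->//|st].
  have [|c /andP[sc ct] fst] := @mean_value _ f df s t st.
    by move=> z /andP[sz _]; apply: fE; lra.
  by rewrite -subr_le0 fst mulr_le0_ge0// ?df0//; lra.
pose g (t : R) := - f (Num.max t 1).
have max0 (t : R) : 0 < Num.max t 1 by rewrite lt_max ltr01 orbT.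
have : g t @[t --> +oo] --> sup (range g).
  apply: nondecreasing_cvgr.
    move=> s t st; rewrite lerN2; apply: f_noninc => //.
    by rewrite ge_max !le_max st lexx orbT.
  by exists (- B) => _ [t _ <-]; rewrite lerN2 fB.
move=> /cvgN gl; exists (- sup (range g)); apply: cvg_trans gl.
apply: near_eq_cvg; near=> t; rewrite /g opprK/=; congr f.
by rewrite max_l//; near: t; apply: nbhs_pinfty_ge; rewrite num_real.
Unshelve. all: by end_near. Qed.

(** * The energy estimate *)

Lemma le_max_param (R : realType) (N : nat) (x : 'I_N -> R) i : x i <= max_param x.
Proof. exact: le_bigmax. Qed.

Lemma min_param_le (R : realType) (N : nat) (x : 'I_N -> R) i : min_param x <= x i.
Proof. exact: bigmin_le. Qed.

Lemma min_param_gt0 (R : realType) (N : nat) (x : 'I_N -> R) : (0 < N)%N ->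
  (forall i, 0 < x i) -> 0 < min_param x.
Proof.
case: N x => // n x _ x0; rewrite /min_param; elim/big_rec: _ => [|i y _ y0].
  exact: lt_le_trans (le_max_param x ord0).
by rewrite lt_min x0.
Qed.

Lemma min_le_max_param (R : realType) (N : nat) (x : 'I_N -> R) : (0 < N)%N ->
  min_param x <= max_param x.
Proof.
by case: N x => // n x _; apply: le_trans (min_param_le x ord0) (le_max_param x ord0).
Qed.

Lemma lambdaE (R : realType) (N : nat) (m d : 'I_N -> R) :
  lambda m d = enorm (fluct d) / Num.sqrt N%:R + 2 * enorm (fluct m) / Num.sqrt N%:R.
Proof.
have tr x : \tr (@fluct_mx R N x *m fluct_mx x) = sqnorm (fluct x).
  rewrite /fluct_mx mulmx_diag mxtrace_diag; apply: eq_bigr => i _.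
  by rewrite !mxE expr2.
by rewrite /lambda !tr.
Qed.

Lemma lambda_ge0 (R : realType) (N : nat) (m d : 'I_N -> R) : 0 <= lambda m d.
Proof. by rewrite lambdaE addr_ge0// divr_ge0 ?mulr_ge0 ?enorm_ge0 ?sqrtr_ge0. Qed.

(** Termwise, the energy minus [m_i / 2 * w_i^2] and
    [(eps d_i - 2 eps^2 m_i) y_i^2] is the square
    [m_i / 2 * (w_i + 2 eps y_i)^2]. *)
Lemma C_0_le_energy (R : realType) (N : nat) (m d : 'I_N -> R) (eps : R)
    (x w : 'I_N -> R) : (0 < N)%N ->
  (forall i, 0 < m i) -> (forall i, 0 < d i) -> 0 < eps ->
  C_0 m d eps * (sqnorm (fluct x) + sqnorm w) <= energy0 m d eps x w.
Proof.
move=> N0 m0 d0 e0; rewrite /energy0 /sqnorm -!big_split/= !mulr_sumr -!big_split/=.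
apply: ler_sum => i _; rewrite -/(fluct x i); set y := fluct x i.
have dl0 := min_param_gt0 N0 d0.
have C0m : C_0 m d eps <= m i / 2.
  have := min_param_le m i.
  by move=> ?; rewrite ge_min; apply/orP; left; lra.
have C0d : C_0 m d eps <= eps * d i - 2 * eps ^+ 2 * m i.
  rewrite ge_min; apply/orP; right.
  have -> : eps * min_param d * (1 - 2 * eps * (max_param m / min_param d)) =
    eps * min_param d - 2 * eps ^+ 2 * max_param m by field; lra.
  by rewrite lerB// ler_wpM2l ?min_param_le ?le_max_param// ?mulr_ge0 ?sqr_ge0// ltW.
have : 0 <= m i / 2 * (w i + 2 * eps * y) ^+ 2.
  by rewrite mulr_ge0 ?sqr_ge0// divr_ge0// ltW.
have := ler_wpM2r (sqr_ge0 y) C0d; have := ler_wpM2r (sqr_ge0 (w i)) C0m.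
lra.
Qed.

(** The companion of [C_0_le_energy], with the square
    [m_i / 2 * (w_i - 2 eps y_i)^2] as the deficit. *)
Lemma energy_le_C_1 (R : realType) (N : nat) (m d : 'I_N -> R) (eps : R)
    (x w : 'I_N -> R) : (0 < N)%N ->
  (forall i, 0 < m i) -> (forall i, 0 < d i) -> 0 < eps ->
  energy0 m d eps x w <= C_1 m d eps * (sqnorm (fluct x) + sqnorm w).
Proof.
move=> N0 m0 d0 e0; rewrite /energy0 /sqnorm -!big_split/= !mulr_sumr -!big_split/=.
apply: ler_sum => i _; rewrite -/(fluct x i); set y := fluct x i.
have dl0 := min_param_gt0 N0 d0.
have mi := le_max_param m i.
have mu0 : 0 < max_param m := lt_le_trans (m0 i) mi.
have C1m : 3 * m i / 2 <= C_1 m d eps.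
  by rewrite le_max; apply/orP; left; lra.
have C1d : eps * d i + 2 * eps ^+ 2 * m i <= C_1 m d eps.
  rewrite le_max; apply/orP; right.
  have -> : eps * max_param d * (1 + 2 * eps * (max_param m / min_param d)) =
    eps * max_param d + 2 * eps ^+ 2 * (max_param m * (max_param d / min_param d)).
    by field; lra.
  rewrite lerD ?ler_wpM2l ?le_max_param ?mulr_ge0 ?sqr_ge0// ?(ltW e0)//.
  rewrite (le_trans mi)// ler_peMr ?(ltW mu0)//.
  by rewrite ler_pdivlMr// mul1r min_le_max_param.
have : 0 <= m i / 2 * (w i - 2 * eps * y) ^+ 2.
  by rewrite mulr_ge0 ?sqr_ge0// divr_ge0// ltW.
have := ler_wpM2r (sqr_ge0 y) C1d; have := ler_wpM2r (sqr_ge0 (w i)) C1m.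
lra.
Qed.

Definition coupling (R : realType) (N : nat) (a : 'M[R]_N) (x : 'I_N -> R)
    (i : 'I_N) : R := \sum_j a i j * sin (x j - x i).

Lemma sum_mul_coupling (R : realType) (N : nat) (a : 'M[R]_N) (x y : 'I_N -> R) :
  (forall i j, a i j = a j i) ->
  2 * \sum_i y i * coupling a x i =
    \sum_i \sum_j a i j * sin (x j - x i) * (y i - y j).
Proof.
by move=> a_sym; apply: sum_antisym => i j; rewrite a_sym -mulrN -sinN opprB.
Qed.

(** Tested against the fluctuations, the coupling is a sum of
    [- a_ij (x_i - x_j) sin (x_i - x_j)] over pairs, and the chord bound applies
    to each pair as long as the spread is at most [D0]. *)
Lemma coupling_restoring (R : realType) (N : nat) (a : 'M[R]_N) (D0 : R)
    (x : 'I_N -> R) :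
  (forall i j, a i j = a j i) -> (forall i j, 0 <= a i j) ->
  graph_connected a -> 0 <= a_l a -> 0 < D0 -> D0 < pi ->
  (forall i j, `|x i - x j| <= D0) ->
  \sum_i fluct x i * coupling a x i <=
    - (R_0 D0 * a_l a * L_star a * N%:R * sqnorm (fluct x)).
Proof.
move=> a_sym a_ge0 conn al0 D0_gt0 D0_pi xD.
have R0_ge0 : 0 <= R_0 D0.
  by rewrite divr_ge0 ?sin_ge0_pi ?ltW// in_itv/=; lra.
have h_ge i j : R_0 D0 * (x i - x j) ^+ 2 <= (x i - x j) * sin (x i - x j).
  exact: sin_chord.
have := coupling_coercive a_sym a_ge0 conn R0_ge0 al0 h_ge.
have := @sum_mul_coupling _ _ a x (fluct x) a_sym.
have -> : \sum_i \sum_j a i j * sin (x j - x i) * (fluct x i - fluct x j) =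
   - \sum_i \sum_j a i j * ((x i - x j) * sin (x i - x j)).
  rewrite -sumrN; apply: eq_bigr => i _; rewrite -sumrN; apply: eq_bigr => j _.
  by rewrite fluctB -(opprB (x i)) sinN; ring.
lra.
Qed.

Lemma sqnorm_fluct_le (R : realType) (N : nat) (x : 'I_N -> R) :
  sqnorm (fluct x) <= sqnorm x.
Proof.
have -> : sqnorm x = sqnorm (fluct x) + \sum_(i < N) mean x ^+ 2.
  have -> : sqnorm x = \sum_i (fluct x i ^+ 2 + (2 * mean x) * fluct x i + mean x ^+ 2).
    by apply: eq_bigr => i _; rewrite /fluct; ring.
  by rewrite !big_split/= -mulr_sumr sum_fluct mulr0 addr0.
by rewrite lerDl sumr_ge0// => i _; rewrite sqr_ge0.
Qed.

(** The power of the coupling is written over pairs before applying Young's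
    inequality; estimating the force at each vertex separately would lose a
    factor 2 in front of [a_u^2]. *)
Lemma coupling_power_le (R : realType) (N : nat) (a : 'M[R]_N) (D : R)
    (x w : 'I_N -> R) :
  (0 < N)%N -> (forall i j, a i j = a j i) -> (forall i j, 0 <= a i j) -> 0 < D ->
  2 * \sum_i w i * coupling a x i <=
    D * sqnorm w + a_u a ^+ 2 * N%:R ^+ 2 / D * sqnorm (fluct x).
Proof.
move=> N0 a_sym a_ge0 D0; rewrite sum_mul_coupling//.
have n0 : 0 < N%:R :> R by rewrite ltr0n.
set n : R := N%:R in n0 *.
(* The weights have product [a_u^2 / 4], as Young requires, and become [D] and
   [a_u^2 n^2 / D] after multiplication by the factor [2 n] of [sqnorm_fluct]. *)
apply: (@le_trans _ _ (\sum_i \sum_j (D / (2 * n) * (w i - w j) ^+ 2 +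
    a_u a ^+ 2 * n / (2 * D) * (x i - x j) ^+ 2))); last first.
  under eq_bigr do rewrite big_split/= -!mulr_sumr.
  rewrite big_split/= -!mulr_sumr !sqnorm_fluct -/n.
  have -> : D / (2 * n) * (2 * n * sqnorm (fluct w)) = D * sqnorm (fluct w).
    by field; lra.
  have -> : a_u a ^+ 2 * n / (2 * D) * (2 * n * sqnorm (fluct x)) =
      a_u a ^+ 2 * n ^+ 2 / D * sqnorm (fluct x).
    by field; lra.
  by rewrite lerD2r ler_wpM2l ?sqnorm_fluct_le// ltW.
apply: ler_sum => i _; apply: ler_sum => j _.
have le1 : a i j * sin (x j - x i) * (w i - w j) <=
    a_u a * `|x i - x j| * `|w i - w j|.
  rewrite (le_trans (ler_norm _))// !normrM (ger0_norm (a_ge0 _ _)).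
  rewrite ler_wpM2r// ler_pM// ?le_a_u// -(normrN (x i - x j)) opprB.
  exact: sin_lipschitz.
apply: (le_trans le1).
rewrite -[(w i - w j) ^+ 2]real_normK ?num_real//.
rewrite -[(x i - x j) ^+ 2]real_normK ?num_real//.
set p := `|x i - x j|; set q := `|w i - w j|; set A := a_u a.
have -> : D / (2 * n) * q ^+ 2 + A ^+ 2 * n / (2 * D) * p ^+ 2 =
   A * p * q + (D * q - A * n * p) ^+ 2 / (2 * n * D).
  by field; apply/andP; split; lra.
by rewrite lerDl divr_ge0 ?sqr_ge0// !mulr_ge0// ltW.
Qed.

Lemma mean_le_enorm (R : realType) (N : nat) (w : 'I_N -> R) : (0 < N)%N ->
  `|mean w| <= enorm w / Num.sqrt N%:R.
Proof.
move=> N0; have n0 : 0 < N%:R :> R by rewrite ltr0n.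
have s0 : 0 < Num.sqrt N%:R :> R by rewrite sqrtr_gt0.
rewrite ler_pdivlMr// /mean.
have := enorm_cauchy_schwarz w (fun=> 1).
under eq_bigr do rewrite mulr1.
have -> : @enorm R N (fun=> 1) = Num.sqrt N%:R.
  rewrite /enorm; congr Num.sqrt.
  by rewrite (eq_bigr (fun=> 1)) ?sumr_const ?card_ord// => i _; rewrite expr1n.
rewrite normrM ger0_norm ?invr_ge0 ?ler0n// => le_sum.
have nE : N%:R = Num.sqrt N%:R ^+ 2 :> R by rewrite sqr_sqrtr// ltW.
set s := Num.sqrt _ in nE s0 le_sum *; rewrite nE; set v := `|_| in le_sum *.
have -> : (s ^+ 2)^-1 * v * s = v / s by field; lra.
by rewrite ler_pdivrMr.
Qed.

(** The time derivative of the energy as a function of the state: the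
    accelerations have been replaced by forces. *)
Definition energy_rate (R : realType) (N : nat) (m d Omega : 'I_N -> R)
    (a : 'M[R]_N) (eps : R) (x w : 'I_N -> R) : R :=
  let F i := Omega i + coupling a x i - d i * w i in
  2 * eps * (\sum_i d i * (fluct x i * fluct w i)) +
  2 * eps * (\sum_i (m i * (fluct w i * w i) + fluct x i * F i)) +
  2 * \sum_i w i * F i.

(** Velocities enter the energy without their mean removed, so the derivative
    contains the mean velocity times [sum_i d_i y_i] and [sum_i m_i w_i]. Up to
    terms of good sign only the fluctuations of [d] and [m] survive in these
    sums, which is where [lambda] comes from. The other terms are the friction,
    the restoring action of the coupling, its power, and the work of
    [Omega]. *)
Lemma energy_dissipation (R : realType) (N : nat) (m d Omega : 'I_N -> R)
    (a : 'M[R]_N) (eps D0 : R) (x w : 'I_N -> R) :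
  (0 < N)%N -> (forall i, 0 < m i) -> (forall i, 0 < d i) ->
  (forall i j, a i j = a j i) -> (forall i j, 0 <= a i j) ->
  graph_connected a -> 0 <= a_l a -> 0 < D0 -> D0 < pi -> 0 < eps ->
  (forall i j, `|x i - x j| <= D0) ->
  energy_rate m d Omega a eps x w <=
    - C_l_tilde m d a D0 eps * (sqnorm (fluct x) + sqnorm w) +
    2 * (eps * enorm (fluct x) + enorm w) * enorm Omega.
Proof.
move=> N0 m0 d0 a_sym a_ge0 conn al0 D0_gt0 D0_pi e0 xD.
have dl0 := min_param_gt0 N0 d0.
set y := fluct x; pose wc := mean w.
have -> : energy_rate m d Omega a eps x w =
   2 * eps * (\sum_i m i * w i ^+ 2) - 2 * \sum_i d i * w i ^+ 2
   - 2 * eps * (wc * \sum_i d i * y i) - 2 * eps * (wc * \sum_i m i * w i)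
   + 2 * eps * \sum_i y i * coupling a x i + 2 * \sum_i w i * coupling a x i
   + 2 * eps * (\sum_i y i * Omega i) + 2 * \sum_i w i * Omega i.
  rewrite /energy_rate !mulr_sumr -!sumrB -!big_split/=.
  by apply: eq_bigr => i _; rewrite /y /fluct -/wc; ring.
have restoring := coupling_restoring a_sym a_ge0 conn al0 D0_gt0 D0_pi xD.
have power := coupling_power_le x w N0 a_sym a_ge0 dl0.
have wc_le := mean_le_enorm w N0.
rewrite -/y -/wc in restoring power wc_le.
have s0 : 0 < Num.sqrt N%:R :> R by rewrite sqrtr_gt0 ltr0n.
have kin : \sum_i m i * w i ^+ 2 <= max_param m * sqnorm w.
  by rewrite mulr_sumr; apply: ler_sum => i _; rewrite ler_wpM2r ?sqr_ge0 ?le_max_param.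
have fric : min_param d * sqnorm w <= \sum_i d i * w i ^+ 2.
  by rewrite mulr_sumr; apply: ler_sum => i _; rewrite ler_wpM2r ?sqr_ge0 ?min_param_le.
have d_fluct : \sum_i d i * y i = \sum_i fluct d i * y i.
  rewrite /fluct; under [RHS]eq_bigr do rewrite mulrBl.
  by rewrite sumrB -mulr_sumr sum_fluct mulr0 subr0.
have m_fluct : \sum_i m i * w i = \sum_i fluct m i * w i + mean m * N%:R * wc.
  have nwc : N%:R * wc = \sum_i w i by rewrite /wc /mean mulVKf// pnatr_eq0 -lt0n.
  rewrite -mulrA nwc mulr_sumr -big_split/=.
  by apply: eq_bigr => i _; rewrite /fluct; ring.
have young_d : - (2 * (wc * \sum_i d i * y i)) <=
    enorm (fluct d) / Num.sqrt N%:R * (sqnorm y + sqnorm w).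
  rewrite d_fluct -mulrN (le_trans (y := 2 * (enorm w / Num.sqrt N%:R *
      (enorm (fluct d) * enorm y))))//.
    rewrite ler_pM2l// (le_trans (ler_norm _))// normrN normrM ler_pM//.
    exact: enorm_cauchy_schwarz.
  rewrite -!enorm_sqr -subr_ge0.
  have -> : enorm (fluct d) / Num.sqrt N%:R * (enorm y ^+ 2 + enorm w ^+ 2) -
     2 * (enorm w / Num.sqrt N%:R * (enorm (fluct d) * enorm y)) =
     enorm (fluct d) / Num.sqrt N%:R * (enorm y - enorm w) ^+ 2 by ring.
  by rewrite mulr_ge0 ?sqr_ge0// divr_ge0 ?enorm_ge0 ?ltW.
have young_m : - (wc * \sum_i m i * w i) <=
    enorm (fluct m) / Num.sqrt N%:R * sqnorm w.
  rewrite m_fluct mulrDr opprD.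
  have : 0 <= wc * (mean m * N%:R * wc).
    have -> : wc * (mean m * N%:R * wc) = mean m * N%:R * wc ^+ 2 by ring.
    rewrite mulr_ge0 ?sqr_ge0// mulr_ge0 ?ler0n// mulr_ge0 ?invr_ge0 ?ler0n//.
    by rewrite sumr_ge0// => i _; rewrite ltW.
  have : - (wc * \sum_i fluct m i * w i) <= enorm (fluct m) / Num.sqrt N%:R * sqnorm w.
    rewrite (le_trans (ler_norm _))// normrN normrM -enorm_sqr.
    apply: (le_trans (ler_pM _ _ wc_le (enorm_cauchy_schwarz _ _))) => //.
    by rewrite le_eqVlt; apply/orP; left; apply/eqP; ring.
  lra.
have work_y : \sum_i y i * Omega i <= enorm y * enorm Omega.
  exact: le_trans (ler_norm _) (enorm_cauchy_schwarz _ _).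
have work_w : \sum_i w i * Omega i <= enorm w * enorm Omega.
  exact: le_trans (ler_norm _) (enorm_cauchy_schwarz _ _).
have lam := lambdaE m d.
have Cw : C_l_tilde m d a D0 eps <= min_param d - 2 * eps * max_param m - eps *
  lambda m d.
  by rewrite lerD2r ge_min lexx.
have Cy : C_l_tilde m d a D0 eps <=
  2 * eps * R_0 D0 * a_l a * L_star a * N%:R - a_u a ^+ 2 * N%:R ^+ 2 / min_param d
   - eps * lambda m d.
  by rewrite lerD2r ge_min lexx orbT.
have Ad0 : 0 <= enorm (fluct d) / Num.sqrt N%:R.
  by rewrite divr_ge0 ?enorm_ge0 ?ltW.
have Am0 : 0 <= enorm (fluct m) / Num.sqrt N%:R.
  by rewrite divr_ge0 ?enorm_ge0 ?ltW.
rewrite -mulrA in lam.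
have := ler_wpM2r (sqnorm_ge0 w) Cw; have := ler_wpM2r (sqnorm_ge0 y) Cy.
rewrite lam.
move: (sqnorm_ge0 w) (sqnorm_ge0 y) Ad0 Am0.
have e2 : 0 < 2 * eps by lra.
move: (ler_wpM2l (ltW e2) restoring) (ler_wpM2l (ltW e2) kin).
move: (ler_wpM2l (ltW e0) young_d) (ler_wpM2l (ltW e2) young_m).
move: (ler_wpM2l (ltW e2) work_y).
move: power fric work_w.
rewrite -/y.
set Ad := enorm (fluct d) / _; set Am := enorm (fluct m) / _.
set SW := sqnorm w; set SY := sqnorm y.
move=> h1 h2 h3 h4 h5 h6 h7 h8 w0 y0 Ad0 Am0 h9 h10.
have := mulr_ge0 (mulr_ge0 (ltW e0) Am0) y0.
clear -h1 h2 h3 h4 h5 h6 h7 h8 h9 h10.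
lra.
Qed.

(** * Force and parameter bounds *)

(** A lower bound for the coercivity of the coupling when the pair interaction
    has slope at least [k]. *)
Definition stiffness (R : realType) (N : nat) (a : 'M[R]_N) (k : R) : R :=
  k * a_l a * L_star a * N%:R.

Definition net_force (R : realType) (N : nat) (Omega : 'I_N -> R) (a : 'M[R]_N)
    (x : 'I_N -> R) (i : 'I_N) : R := Omega i + coupling a x i.

Lemma stiffness_gt0_a_l (R : realType) (N : nat) (a : 'M[R]_N) (k : R) :
  0 <= k -> 0 < stiffness a k -> 0 < a_l a.
Proof.
move=> k0; rewrite /stiffness; have n0 := ler0n R N; have L0 := L_star_gt0 a.
apply: contraTT; rewrite -!leNgt => al.
exact: mulr_le0_ge0 (mulr_le0_ge0 (mulr_ge0_le0 k0 al) (ltW L0)) n0.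
Qed.

(** A state can be spread only as far as [Omega] and the net force pull it
    against the restoring coupling. *)
Lemma fluct_le_force (R : realType) (N : nat) (a : 'M[R]_N) (Omega : 'I_N -> R)
    (D0 : R) (x : 'I_N -> R) :
  (forall i j, a i j = a j i) -> (forall i j, 0 <= a i j) ->
  graph_connected a -> 0 <= a_l a -> 0 < D0 -> D0 < pi ->
  (forall i j, `|x i - x j| <= D0) ->
  stiffness a (R_0 D0) * enorm (fluct x) <= enorm Omega + enorm (net_force Omega a x).
Proof.
move=> a_sym a_ge0 conn al0 D0_gt0 D0_pi xD.
have := coupling_restoring a_sym a_ge0 conn al0 D0_gt0 D0_pi xD.
rewrite -/(stiffness _ _); set y := fluct x; set G := stiffness _ _.
have -> : \sum_i y i * coupling a x i =
    \sum_i y i * net_force Omega a x i - \sum_i y i * Omega i.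
  by rewrite -sumrB; apply: eq_bigr => i _; rewrite /net_force; ring.
have := enorm_cauchy_schwarz y Omega; have :=
  enorm_cauchy_schwarz y (net_force Omega a x).
rewrite !ler_norml -enorm_sqr => /andP[h1 _] /andP[_ h2] h3.
have := enorm_ge0 y; have := enorm_ge0 Omega; have := enorm_ge0 (net_force Omega a x).
set p := enorm y in h1 h2 h3 *; set f := enorm (net_force _ _ _) in h1 *.
set o := enorm Omega in h2 * => f0 o0 p0.
have [->|p_neq0] := eqVneq p 0; first lra.
have {}p0 : 0 < p by lra.
by rewrite -(ler_pM2r p0); lra.
Qed.

(** Below spread [pi / 2] the sine is strictly increasing, hence the coupling is
    strongly monotone: two states with small net force are close up to
    rotation. *)
Lemma fluct_dist_le_force (R : realType) (N : nat) (a : 'M[R]_N) (Omega : 'I_N -> R)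
    (D : R) (x x' : 'I_N -> R) :
  (forall i j, a i j = a j i) -> (forall i j, 0 <= a i j) ->
  graph_connected a -> 0 <= a_l a -> 0 <= D -> D <= pi / 2 ->
  (forall i j, `|x i - x j| <= D) -> (forall i j, `|x' i - x' j| <= D) ->
  stiffness a (cos D) * enorm (fluct (fun i => x i - x' i)) <=
    enorm (net_force Omega a x) + enorm (net_force Omega a x').
Proof.
move=> a_sym a_ge0 conn al0 D_ge0 D_pi xD x'D.
have pi0 := pi_gt0 R.
have c0 : 0 <= cos D by apply: cos_ge0_pihalf; lra.
set z := fun i => _; set y := fluct z.
pose h i j := (sin (x i - x j) - sin (x' i - x' j)) * (z i - z j).
have h_ge i j : cos D * (z i - z j) ^+ 2 <= h i j.
  rewrite /h; have -> : z i - z j = (x i - x j) - (x' i - x' j) by rewrite /z; ring.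
  by apply: sin_strong_monotone => //; lra.
have := coupling_coercive a_sym a_ge0 conn c0 al0 h_ge.
rewrite -/(stiffness _ _) -/y; set G := stiffness _ _.
have -> : \sum_i \sum_j a i j * h i j =
    2 * \sum_i y i * (net_force Omega a x' i - net_force Omega a x i).
  have -> : \sum_i y i * (net_force Omega a x' i - net_force Omega a x i) =
      \sum_i y i * coupling a x' i - \sum_i y i * coupling a x i.
    by rewrite -sumrB; apply: eq_bigr => i _; rewrite /net_force; ring.
  rewrite mulrBr !sum_mul_coupling// -sumrB; apply: eq_bigr => i _.
  rewrite -sumrB; apply: eq_bigr => j _.
  by rewrite /h /y fluctB -(opprB (x i)) -(opprB (x' i)) !sinN; ring.
have -> : \sum_i y i * (net_force Omega a x' i - net_force Omega a x i) =
   \sum_i y i * net_force Omega a x' i - \sum_i y i * net_force Omega a x i.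
  by rewrite -sumrB; apply: eq_bigr => i _; ring.
have := enorm_cauchy_schwarz y (net_force Omega a x).
have := enorm_cauchy_schwarz y (net_force Omega a x').
rewrite !ler_norml -enorm_sqr => /andP[_ h1] /andP[h2 _] h3.
have := enorm_ge0 y; have := enorm_ge0 (net_force Omega a x').
have := enorm_ge0 (net_force Omega a x).
set p := enorm y in h1 h2 h3 *; set f := enorm (net_force Omega a x) in h2 *.
set f' := enorm (net_force Omega a x') in h1 * => f0 f'0 p0.
have [->|p_neq0] := eqVneq p 0; first lra.
have {}p0 : 0 < p by lra.
by rewrite -(ler_pM2r p0); lra.
Qed.

(** On this level set [X <= (D0 / 2)^2], so that the spread is at most [D0] and
    [energy_dissipation] applies, while [X >= C_0 / C_1 * (D0 / 2)^2] keeps the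
    dissipation ahead of the work of [Omega]. *)
Lemma energy_rate_lt0 (R : realType) (N : nat) (m d Omega : 'I_N -> R)
    (a : 'M[R]_N) (eps D0 : R) (x w : 'I_N -> R) :
  (0 < N)%N -> (forall i, 0 < m i) -> (forall i, 0 < d i) ->
  (forall i j, a i j = a j i) -> (forall i j, 0 <= a i j) ->
  graph_connected a -> 0 <= a_l a -> 0 < D0 -> D0 < pi -> 0 < eps ->
  0 < C_0 m d eps -> 0 < C_l_tilde m d a D0 eps ->
  2 * Num.sqrt 2 * C_1 m d eps * Num.max eps 1 * enorm Omega <
    C_l_tilde m d a D0 eps * C_0 m d eps * (D0 / 2) ->
  energy0 m d eps x w = C_0 m d eps * (D0 / 2) ^+ 2 ->
  energy_rate m d Omega a eps x w < 0.
Proof.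
move=> N0 m0 d0 a_sym a_ge0 conn al0 D0_gt0 D0_pi e0 C0_gt0 Cl_gt0 Omega_lt Ex.
have lo := C_0_le_energy x w N0 m0 d0 e0; have hi := energy_le_C_1 x w N0 m0 d0 e0.
have X_le : sqnorm (fluct x) + sqnorm w <= (D0 / 2) ^+ 2.
  by rewrite -(ler_pM2l C0_gt0) -Ex.
have y_le : enorm (fluct x) <= D0 / 2.
  apply: enorm_le; first lra.
  by apply: le_trans X_le; rewrite lerDl sqnorm_ge0.
have xD i j : `|x i - x j| <= D0.
  by have := dist_le_enorm_fluct x i j; lra.
have := energy_dissipation Omega w N0 m0 d0 a_sym a_ge0 conn al0 D0_gt0 D0_pi e0 xD.
move=> /le_lt_trans; apply.
rewrite Ex in hi; rewrite -!enorm_sqr in X_le hi *.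
have := enorm_ge0 (fluct x); have := enorm_ge0 w; have := enorm_ge0 Omega.
have C1_gt0 : 0 < C_1 m d eps.
  have := le_max_param m (Ordinal N0); have := m0 (Ordinal N0) => ? ?.
  by rewrite lt_max; apply/orP; left; lra.
have e_mx : eps <= Num.max eps 1 by rewrite le_max lexx.
have mx1 : 1 <= Num.max eps 1 by rewrite le_max lexx orbT.
have s0 := @sqrtr_ge0 R 2.
have s2 : Num.sqrt 2 ^+ 2 = 2 :> R by rewrite sqr_sqrtr.
move: Omega_lt X_le hi e_mx mx1.
set p := enorm (fluct x); set q := enorm w; set o := enorm Omega.
set mx := Num.max eps 1; set C0 := C_0 _ _ _ in C0_gt0 *; set C1 :=
  C_1 _ _ _ in C1_gt0 *.
set Cl := C_l_tilde _ _ _ _ _ in Cl_gt0 *; set s := Num.sqrt 2 in s0 s2 *.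
move=> Omega_lt X_le hi e_mx mx1 o0 q0 p0.
have pq : p + q <= s * (D0 / 2).
  rewrite -(ler_pXn2r (n := 2))// ?nnegrE ?addr_ge0//; last by apply: mulr_ge0; lra.
  rewrite exprMn s2; have := sqr_ge0 (p - q); move: X_le; lra.
have mpq : eps * p + q <= mx * (s * (D0 / 2)).
  apply: (@le_trans _ _ (mx * (p + q))).
    by rewrite mulrDr lerD ?ler_wpM2r// ler_peMl.
  by rewrite ler_wpM2l//; lra.
rewrite -(ltr_pM2l C1_gt0) mulr0.
have h1 : C1 * (2 * (eps * p + q) * o) <= C1 * (2 * (mx * (s * (D0 / 2))) * o).
  by rewrite ler_pM2l// ler_wpM2r// ler_pM2l.
have h2 : Cl * (C0 * (D0 / 2) ^+ 2) <= Cl * (C1 * (p ^+ 2 + q ^+ 2)).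
  by rewrite ler_pM2l.
have D2 : 0 < D0 / 2 by lra.
rewrite -(ltr_pM2r D2) in Omega_lt.
lra.
Qed.

(** The last inequality confines equilibria to a spread well below [D0]. It
    follows from the smallness of [Omega] by [3 C_0 <= C_1], because
    [C_0 <= m_l / 2] and [C_1 >= 3 m_u / 2], and by
    [C_l_tilde <= 2 * eps * stiffness]. *)
Lemma parameter_bounds (R : realType) (N : nat) (m d Omega : 'I_N -> R)
    (a : 'M[R]_N) (eps D0 E0 : R) :
  (0 < N)%N -> (forall i, 0 < m i) -> (forall i, 0 < d i) -> 0 < D0 -> D0 < pi ->
  a_u a ^+ 2 * N%:R ^+ 2 * (2 * max_param m + lambda m d) <
    min_param d ^+ 2 *
      (2 * R_0 D0 * a_l a * L_star a * N%:R - lambda m d) ->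
  a_u a ^+ 2 * N%:R ^+ 2 /
    (min_param d * (2 * R_0 D0 * a_l a * L_star a * N%:R - lambda m d)) < eps ->
  eps < min_param d / (2 * max_param m + lambda m d) ->
  Num.max (Num.sqrt E0)
    (2 * Num.sqrt 2 * C_1 m d eps * Num.max eps 1 * enorm Omega /
      (C_l_tilde m d a D0 eps * Num.sqrt (C_0 m d eps)))
    < Num.sqrt (C_0 m d eps) / 2 * D0 ->
  [/\ 0 < a_l a, 0 < eps, 0 < C_0 m d eps & 0 < C_l_tilde m d a D0 eps] /\
  [/\ 0 < stiffness a (R_0 D0),
      E0 < C_0 m d eps * (D0 / 2) ^+ 2,
      2 * Num.sqrt 2 * C_1 m d eps * Num.max eps 1 * enorm Omega <
        C_l_tilde m d a D0 eps * C_0 m d eps * (D0 / 2) &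
      6 * enorm Omega <= stiffness a (R_0 D0) * D0].
Proof.
move=> N0 m0 d0 D0_gt0 D0_pi H2 eps_gt eps_lt.
rewrite gt_max => /andP[E0_lt Omega_lt].
have dl := min_param_gt0 N0 d0; have ml := min_param_gt0 N0 m0.
have mlu := min_le_max_param m N0; have lam := lambda_ge0 m d.
have R0_gt0 : 0 < R_0 D0 by rewrite divr_gt0// sin_gt0_pi// D0_gt0.
have GE : 2 * R_0 D0 * a_l a * L_star a * N%:R = 2 * stiffness a (R_0 D0).
  by rewrite /stiffness; ring.
rewrite GE in H2 eps_gt.
have aN0 : 0 <= a_u a ^+ 2 * N%:R ^+ 2 by rewrite mulr_ge0 ?sqr_ge0.
have G2 : 0 < 2 * stiffness a (R_0 D0) - lambda m d.
  rewrite -(pmulr_rgt0 _ (exprn_gt0 2 dl)); apply: le_lt_trans H2.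
  by rewrite mulr_ge0//; lra.
have G_gt0 : 0 < stiffness a (R_0 D0) by lra.
have al_gt0 := stiffness_gt0_a_l (ltW R0_gt0) G_gt0.
have e0 : 0 < eps by apply: le_lt_trans eps_gt; rewrite divr_ge0// mulr_ge0// ltW.
rewrite ltr_pdivlMr in eps_lt; last lra.
rewrite ltr_pdivrMr in eps_gt; last exact: mulr_gt0.
have C0_gt0 : 0 < C_0 m d eps.
  rewrite lt_min; apply/andP; split; first lra.
  rewrite mulr_gt0 ?mulr_gt0// mulrA subr_gt0 ltr_pdivrMr//.
  have := mulr_ge0 (ltW e0) lam; lra.
have Cl_le : C_l_tilde m d a D0 eps <= 2 * eps * stiffness a (R_0 D0).
  have : C_l_tilde m d a D0 eps <= 2 * eps * stiffness a (R_0 D0)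
     - a_u a ^+ 2 * N%:R ^+ 2 / min_param d - eps * lambda m d.
    rewrite lerD2r ge_min; apply/orP; right.
    by rewrite lerD2r /stiffness !mulrA.
  have : 0 <= a_u a ^+ 2 * N%:R ^+ 2 / min_param d by rewrite divr_ge0// ltW.
  have := mulr_ge0 (ltW e0) lam; lra.
have Cl_gt0 : 0 < C_l_tilde m d a D0 eps.
  rewrite subr_gt0 lt_min; apply/andP; split; first lra.
  rewrite ltrBrDr.
  have -> : 2 * eps * R_0 D0 * a_l a * L_star a * N%:R = 2 * eps * stiffness a (R_0 D0).
    by rewrite /stiffness; ring.
  by rewrite -ltrBrDl ltr_pdivrMr//; lra.
have sC0 : 0 < Num.sqrt (C_0 m d eps) by rewrite sqrtr_gt0.
have sC0E : Num.sqrt (C_0 m d eps) ^+ 2 = C_0 m d eps by rewrite sqr_sqrtr// ltW.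
have E0_lt' : E0 < C_0 m d eps * (D0 / 2) ^+ 2.
  have : 0 < Num.sqrt (C_0 m d eps) / 2 * D0 by rewrite mulr_gt0 ?divr_gt0.
  have [E0neg _|E0pos B0] := ltP E0 0.
    by apply: lt_trans E0neg _; rewrite mulr_gt0 ?exprn_gt0 ?divr_gt0.
  have -> : C_0 m d eps * (D0 / 2) ^+ 2 = (Num.sqrt (C_0 m d eps) / 2 * D0) ^+ 2.
    by rewrite -[in LHS]sC0E; field.
  by rewrite -(sqr_sqrtr E0pos) ltr_pXn2r// nnegrE ?sqrtr_ge0// ltW.
have Omega_lt' : 2 * Num.sqrt 2 * C_1 m d eps * Num.max eps 1 * enorm Omega <
        C_l_tilde m d a D0 eps * C_0 m d eps * (D0 / 2).
  move: Omega_lt; rewrite ltr_pdivrMr ?mulr_gt0// => /lt_le_trans; apply.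
  by rewrite -[C_0 m d eps in leRHS]sC0E; lra.
split=> //; split=> //.
have C1_ge : 3 * C_0 m d eps <= C_1 m d eps.
  have c0m : C_0 m d eps <= min_param m / 2 by rewrite ge_min lexx.
  have c1m : 3 * max_param m / 2 <= C_1 m d eps by rewrite le_max lexx.
  lra.
have e_mx : eps <= Num.max eps 1 by rewrite le_max lexx.
have s1 : 1 <= Num.sqrt 2 :> R.
  by rewrite -[leLHS]sqrtr1 ler_wsqrtr// (ler_nat R 1 2).
have o0 := enorm_ge0 Omega.
have mx0 : 0 < Num.max eps 1 by lra.
have C1_gt0 : 0 < C_1 m d eps by lra.
move: Omega_lt'; set mx := Num.max eps 1 in mx0 e_mx *; set o := enorm Omega in o0 *.
set G := stiffness _ _ in G_gt0 Cl_le *; set C0 := C_0 _ _ _ in C0_gt0 C1_ge *.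
set C1 := C_1 _ _ _ in C1_ge C1_gt0 *; set Cl := C_l_tilde _ _ _ _ _ in Cl_le Cl_gt0 *.
set s := Num.sqrt 2 in s1 * => Omega_lt'.
have h1 : Cl * C0 <= (2 * mx * G) * (C1 / 3).
  apply: ler_pM; try lra.
  by apply: le_trans Cl_le _; rewrite ler_pM2r// ler_pM2l.
have h2 : 2 * 1 * C1 * mx * o <= 2 * s * C1 * mx * o.
  by rewrite !ler_wpM2r//; lra.
have h3 : Cl * C0 * (D0 / 2) <= (2 * mx * G) * (C1 / 3) * (D0 / 2).
  by rewrite ler_wpM2r//; lra.
have cm : 0 < C1 * mx / 3 by rewrite divr_gt0 ?mulr_gt0.
by rewrite -(ler_pM2l cm); lra.
Qed.

(** * Confinement of the trajectory *)

Definition bounded_on_pos (R : realType) (f : R -> R) : Prop :=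
  exists K, forall t : R, 0 < t -> `|f t| <= K.

Lemma bounded_on_pos_cst (R : realType) (c : R) : bounded_on_pos (fun=> c).
Proof. by exists `|c|. Qed.

Lemma bounded_on_posD (R : realType) (f g : R -> R) :
  bounded_on_pos f -> bounded_on_pos g -> bounded_on_pos (fun t => f t + g t).
Proof.
move=> [K fK] [L gL]; exists (K + L) => t t0.
by rewrite (le_trans (ler_normD _ _))// lerD ?fK ?gL.
Qed.

Lemma bounded_on_posM (R : realType) (f g : R -> R) :
  bounded_on_pos f -> bounded_on_pos g -> bounded_on_pos (fun t => f t * g t).
Proof.
by move=> [K fK] [L gL]; exists (K * L) => t t0; rewrite normrM ler_pM ?fK ?gL.
Qed.

Lemma bounded_on_posN (R : realType) (f : R -> R) :
  bounded_on_pos f -> bounded_on_pos (fun t => - f t).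
Proof. by move=> [K fK]; exists K => t t0; rewrite normrN fK. Qed.

Lemma bounded_on_pos_sum (R : realType) (n : nat) (f : 'I_n -> R -> R) :
  (forall i, bounded_on_pos (f i)) -> bounded_on_pos (fun t => \sum_i f i t).
Proof.
move=> /choice[K fK]; exists (\sum_i K i) => t t0.
by rewrite (le_trans (ler_norm_sum _ _ _))//; apply: ler_sum => i _; exact: fK.
Qed.

Lemma bounded_on_pos_sin (R : realType) (f : R -> R) : bounded_on_pos (fun t =>
  sin (f t)).
Proof. by exists 1 => t _; rewrite ler_norml sin_geN1 sin_le1. Qed.

Lemma bounded_on_pos_cos (R : realType) (f : R -> R) : bounded_on_pos (fun t =>
  cos (f t)).
Proof. by exists 1 => t _; rewrite ler_norml cos_geN1 cos_le1. Qed.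

Definition accel (R : realType) (N : nat) (m d Omega : 'I_N -> R) (a : 'M[R]_N)
    (x w : 'I_N -> R) (i : 'I_N) : R :=
  (net_force Omega a x i - d i * w i) / m i.

Lemma solution_is_derive (R : realType) (N : nat) (m d Omega : 'I_N -> R)
    (a : 'M[R]_N) (theta omega : 'I_N -> R -> R) :
  (forall i, 0 < m i) -> kuramoto_solution m d Omega a theta omega ->
  forall t : R, 0 < t -> forall i,
    is_derive t 1 (theta i) (omega i t) /\
    is_derive t 1 (omega i) (accel m d Omega a (theta ^~ t) (omega ^~ t) i).
Proof.
move=> m0 [_ sol] t t0 i; have [dth th dom eqn] := sol i t t0.
split; apply: DeriveDef => //.
  by rewrite -derive1E.
rewrite -derive1E.
have m_neq0 : m i != 0 by rewrite gt_eqF.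
by rewrite /accel /net_force /coupling -eqn th; field.
Qed.

Lemma coupling_is_derive (R : realType) (N : nat) (a : 'M[R]_N)
    (theta omega : 'I_N -> R -> R) (t : R) i :
  (forall i, is_derive t 1 (theta i) (omega i t)) ->
  is_derive t 1 (fun s => coupling a (theta ^~ s) i)
    (\sum_j a i j * (cos (theta j t - theta i t) * (omega j t - omega i t))).
Proof.
move=> dth; apply: is_derive_sumf => j; apply: is_derive_scalef.
Qed.

Lemma fluct_is_derive (R : realType) (N : nat)
    (theta omega : 'I_N -> R -> R) (t : R) i :
  (forall i, is_derive t 1 (theta i) (omega i t)) ->
  is_derive t 1 (fun s => fluct (theta ^~ s) i) (fluct (omega ^~ t) i).
Proof.
move=> dth; apply: is_derive_subf => //; apply: is_derive_scalef.
exact: is_derive_sumf.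
Qed.

Lemma energy_is_derive (R : realType) (N : nat) (m d Omega : 'I_N -> R)
    (a : 'M[R]_N) (eps : R) (theta omega : 'I_N -> R -> R) (t : R) :
  (forall i, 0 < m i) ->
  (forall i, is_derive t 1 (theta i) (omega i t)) ->
  (forall i, is_derive t 1 (omega i) (accel m d Omega a (theta ^~ t) (omega ^~ t) i)) ->
  is_derive t 1 (fun s => energy0 m d eps (theta ^~ s) (omega ^~ s))
    (energy_rate m d Omega a eps (theta ^~ t) (omega ^~ t)).
Proof.
move=> m0 dth dom.
have dfl i := fluct_is_derive i dth.
have dkin : is_derive t 1 (fun s => \sum_i m i * omega i s ^+ 2)
   (\sum_i m i * (2 * omega i t * accel m d Omega a (theta ^~ t) (omega ^~ t) i)).
  by apply: is_derive_sumf => i; apply: is_derive_scalef; apply: is_derive_sqrf.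
have dpot : is_derive t 1 (fun s => eps * \sum_i d i * fluct (theta ^~ s) i ^+ 2)
   (eps * \sum_i d i * (2 * fluct (theta ^~ t) i * fluct (omega ^~ t) i)).
  apply: is_derive_scalef; apply: is_derive_sumf => i; apply: is_derive_scalef.
  exact: is_derive_sqrf.
have dmix : is_derive t 1 (fun s => 2 * eps * \sum_i m i * fluct (theta ^~ s) i *
  omega i s)
   (2 * eps * \sum_i (m i * fluct (omega ^~ t) i * omega i t +
     m i * fluct (theta ^~ t) i * accel m d Omega a (theta ^~ t) (omega ^~ t) i)).
  apply: is_derive_scalef; apply: is_derive_sumf => i; apply: is_derive_mulf => //.
have dE := is_derive_addf (is_derive_addf dpot dmix) dkin.
apply: (is_derive_eq dE).
rewrite /energy_rate !mulr_sumr -!big_split/=; apply: eq_bigr => i _.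
have m_neq0 : m i != 0 by rewrite gt_eqF.
by rewrite /accel /net_force; field.
Qed.

Lemma cvg_sumf (R : realType) (n : nat) (F : set_system R) (FF : Filter F)
    (f : 'I_n -> R -> R) (l : 'I_n -> R) :
  (forall i, f i t @[t --> F] --> l i) -> \sum_i f i t @[t --> F] --> \sum_i l i.
Proof.
move=> fl; apply: cvg_big => [|i _]; [exact: add_continuous | exact: fl].
Qed.

Lemma energy_cvg_at_right (R : realType) (N : nat) (m d Omega : 'I_N -> R)
    (a : 'M[R]_N) (eps : R) (theta omega : 'I_N -> R -> R) :
  kuramoto_solution m d Omega a theta omega ->
  energy0 m d eps (theta ^~ t) (omega ^~ t) @[t --> 0^'+] -->
    energy0 m d eps (theta ^~ 0) (omega ^~ 0).
Proof.
move=> [cont _].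
have th i : theta i t @[t --> 0^'+] --> theta i 0.
  by have [/continuous_within_itvcyP[]] := cont i.
have om i : omega i t @[t --> 0^'+] --> omega i 0.
  by have [_ /continuous_within_itvcyP[]] := cont i.
have fl i : fluct (theta ^~ t) i @[t --> 0^'+] --> fluct (theta ^~ 0) i.
  by apply: cvgB => //; apply: cvgMl_tmp; apply: cvg_sumf.
apply: cvgD; first apply: cvgD.
- apply: cvgMl_tmp; apply: cvg_sumf => i; apply: cvgMl_tmp.
  by apply: cvgM; exact: fl.
- apply: cvgMl_tmp; apply: cvg_sumf => i; apply: cvgM => //; apply: cvgMl_tmp;
  exact: fl.
- by apply: cvg_sumf => i; apply: cvgMl_tmp; apply: cvgM.
Qed.

(** The differential equation is available only for positive times; right
    continuity at 0 carries the bound on the initial energy to a small positive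
    time, from which [barrier] takes over. *)
Lemma energy_trapping (R : realType) (N : nat) (m d Omega : 'I_N -> R)
    (a : 'M[R]_N) (eps D0 : R) (theta omega : 'I_N -> R -> R) :
  (0 < N)%N -> (forall i, 0 < m i) -> (forall i, 0 < d i) ->
  (forall i j, a i j = a j i) -> (forall i j, 0 <= a i j) ->
  graph_connected a -> 0 <= a_l a -> 0 < D0 -> D0 < pi -> 0 < eps ->
  0 < C_0 m d eps -> 0 < C_l_tilde m d a D0 eps ->
  2 * Num.sqrt 2 * C_1 m d eps * Num.max eps 1 * enorm Omega <
    C_l_tilde m d a D0 eps * C_0 m d eps * (D0 / 2) ->
  energy0 m d eps (theta ^~ 0) (omega ^~ 0) < C_0 m d eps * (D0 / 2) ^+ 2 ->
  kuramoto_solution m d Omega a theta omega ->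
  forall t : R, 0 < t ->
    enorm (fluct (theta ^~ t)) <= D0 / 2 /\ enorm (omega ^~ t) <= D0 / 2.
Proof.
move=> N0 m0 d0 a_sym a_ge0 conn al0 D0_gt0 D0_pi e0 C0_gt0 Cl_gt0 Omega_lt E_lt sol.
pose E t := energy0 m d eps (theta ^~ t) (omega ^~ t).
have E_trap (t : R) : 0 < t -> E t < C_0 m d eps * (D0 / 2) ^+ 2.
  move=> t0.
  have near0 : \forall s \near 0^'+, E s < C_0 m d eps * (D0 / 2) ^+ 2.
    have /cvgr_lt := energy_cvg_at_right (m := m) (d := d) (eps := eps) sol.
    exact.
  have [s [s0 st Es]] : exists s, [/\ 0 < s, s <= t & E s < C_0 m d eps * (D0 / 2)
    ^+ 2].
    near (0 : R)^'+ => s; exists s; split; near: s => //.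
      exact: nbhs_right_gt.
    exact: nbhs_right_le.
  apply: (@barrier _ E (fun t => energy_rate m d Omega a eps (theta ^~ t) (omega ^~
    t)) s) => // u su.
    have u0 : 0 < u by lra.
    by apply: energy_is_derive => // i; have [] := solution_is_derive m0 sol u0 i.
  by apply: energy_rate_lt0.
move=> t t0; have := E_trap t t0.
move=> /(le_lt_trans (C_0_le_energy _ _ N0 m0 d0 e0)); rewrite ltr_pM2l// => /ltW X_le.
by split; apply: enorm_le; try lra; apply: le_trans X_le;
  rewrite ?lerDl ?lerDr sqnorm_ge0.
Unshelve. all: by end_near. Qed.

(** * Vanishing forces and phase locking *)

Definition mech_energy (R : realType) (N : nat) (m Omega : 'I_N -> R)
    (a : 'M[R]_N) (x w : 'I_N -> R) : R :=
  2^-1 * (\sum_i m i * w i ^+ 2) - \sum_i Omega i * x i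
  - 2^-1 * \sum_i \sum_j a i j * cos (x j - x i).

(** The coupling derives from the potential [- sum a_ij cos (x_j - x_i) / 2], and
    [Omega] from a linear one, so only friction changes the mechanical
    energy. *)
Lemma mech_energy_is_derive (R : realType) (N : nat) (m d Omega : 'I_N -> R)
    (a : 'M[R]_N) (theta omega : 'I_N -> R -> R) (t : R) :
  (forall i, 0 < m i) -> (forall i j, a i j = a j i) ->
  (forall i, is_derive t 1 (theta i) (omega i t)) ->
  (forall i, is_derive t 1 (omega i) (accel m d Omega a (theta ^~ t) (omega ^~ t) i)) ->
  is_derive t 1 (fun s => mech_energy m Omega a (theta ^~ s) (omega ^~ s))
    (- \sum_i d i * omega i t ^+ 2).
Proof.
move=> m0 a_sym dth dom.
have dkin : is_derive t 1 (fun s => 2^-1 * \sum_i m i * omega i s ^+ 2)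
   (2^-1 * \sum_i m i * (2 * omega i t * accel m d Omega a (theta ^~ t) (omega ^~
     t) i)).
  apply: is_derive_scalef; apply: is_derive_sumf => i; apply: is_derive_scalef.
  exact: is_derive_sqrf.
have dforce : is_derive t 1 (fun s => \sum_i Omega i * theta i s) (\sum_i Omega i *
  omega i t).
  by apply: is_derive_sumf => i; exact: is_derive_scalef.
have dcos : is_derive t 1 (fun s => 2^-1 * \sum_i \sum_j a i j * cos (theta j s -
  theta i s))
   (2^-1 * \sum_i \sum_j a i j * (- sin (theta j t - theta i t) * (omega j t -
     omega i t))).
  apply: is_derive_scalef; apply: is_derive_sumf => i; apply: is_derive_sumf => j.
have dE := is_derive_subf (is_derive_subf dkin dforce) dcos.
apply: (is_derive_eq dE).
have -> : \sum_i \sum_j a i j * (- sin (theta j t - theta i t) * (omega j t - omega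
  i t)) =
   2 * \sum_i omega i t * coupling a (theta ^~ t) i.
  rewrite (@sum_mul_coupling _ _ a (theta ^~ t) (omega ^~ t))//.
  by apply: eq_bigr => i _; apply: eq_bigr => j _; ring.
rewrite mulKf ?pnatr_eq0// mulr_sumr -!sumrB -sumrN; apply: eq_bigr => i _.
have m_neq0 : m i != 0 by rewrite gt_eqF.
by rewrite /accel /net_force; field.
Qed.

(** Since [Omega] has zero sum, the linear potential only sees the
    fluctuations. *)
Lemma mech_energy_ge (R : realType) (N : nat) (m Omega : 'I_N -> R)
    (a : 'M[R]_N) (x w : 'I_N -> R) :
  (forall i, 0 < m i) -> (forall i j, 0 <= a i j) -> \sum_i Omega i = 0 ->
  - (enorm (fluct x) * enorm Omega) - 2^-1 * \sum_i \sum_j a i j <=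
    mech_energy m Omega a x w.
Proof.
move=> m0 a_ge0 Omega0; rewrite /mech_energy.
have kin : 0 <= \sum_i m i * w i ^+ 2.
  by apply: sumr_ge0 => i _; rewrite mulr_ge0 ?sqr_ge0// ltW.
have -> : \sum_i Omega i * x i = \sum_i fluct x i * Omega i.
  rewrite [RHS](_ : _ = \sum_i (Omega i * x i - mean x * Omega i)).
    by rewrite sumrB -mulr_sumr Omega0 mulr0 subr0.
  by apply: eq_bigr => i _; rewrite /fluct; ring.
have := le_trans (ler_norm _) (enorm_cauchy_schwarz (fluct x) Omega).
have : \sum_i \sum_j a i j * cos (x j - x i) <= \sum_i \sum_j a i j.
  apply: ler_sum => i _; apply: ler_sum => j _.
  by rewrite ler_piMr// cos_le1.
lra.
Qed.

Lemma accel_bounded (R : realType) (N : nat) (m d Omega : 'I_N -> R)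
    (a : 'M[R]_N) (theta omega : 'I_N -> R -> R) i :
  (forall i, bounded_on_pos (omega i)) ->
  bounded_on_pos (fun t => accel m d Omega a (theta ^~ t) (omega ^~ t) i).
Proof.
move=> om; apply: bounded_on_posM; last exact: bounded_on_pos_cst.
apply: bounded_on_posD; last first.
  apply: bounded_on_posN; apply: bounded_on_posM => //; exact: bounded_on_pos_cst.
apply: bounded_on_posD; first exact: bounded_on_pos_cst.
apply: bounded_on_pos_sum => j; apply: bounded_on_posM; first exact: bounded_on_pos_cst.
exact: bounded_on_pos_sin.
Qed.

(** The mechanical energy is nonincreasing and bounded below on the confined
    region; by [barbalat] its dissipation rate, hence each velocity, vanishes at
    infinity. *)
Lemma velocity_cvg0 (R : realType) (N : nat) (m d Omega : 'I_N -> R)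
    (a : 'M[R]_N) (B : R) (theta omega : 'I_N -> R -> R) :
  (forall i, 0 < m i) -> (forall i, 0 < d i) ->
  (forall i j, a i j = a j i) -> (forall i j, 0 <= a i j) -> \sum_i Omega i = 0 ->
  kuramoto_solution m d Omega a theta omega ->
  (forall t : R, 0 < t -> enorm (fluct (theta ^~ t)) <= B /\ enorm (omega ^~ t) <= B) ->
  forall i, omega i t @[t --> +oo] --> 0.
Proof.
move=> m0 d0 a_sym a_ge0 Omega0 sol trap.
have om i : bounded_on_pos (omega i).
  exists B => t t0; have [_] := trap t t0.
  exact: le_trans (normr_le_enorm (omega ^~ t) i).
pose H t := mech_energy m Omega a (theta ^~ t) (omega ^~ t).
have dH (t : R) : 0 < t -> is_derive t 1 H (- \sum_i d i * omega i t ^+ 2).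
  move=> t0; apply: mech_energy_is_derive => // i;
  by have [] := solution_is_derive m0 sol t0 i.
pose k t := - \sum_i d i * (2 * omega i t * accel m d Omega a (theta ^~ t) (omega
  ^~ t) i).
have dk (t : R) : 0 < t -> is_derive t 1 (fun t => - \sum_i d i * omega i t ^+ 2) (k t).
  move=> t0; apply: is_deriveN; apply: is_derive_sumf => i; apply: is_derive_scalef.
  by apply: is_derive_sqrf; have [] := solution_is_derive m0 sol t0 i.
have [K kK] : bounded_on_pos k.
  apply: bounded_on_posN; apply: bounded_on_pos_sum => i.
  apply: bounded_on_posM; first exact: bounded_on_pos_cst.
  apply: bounded_on_posM; last exact: accel_bounded.
  by apply: bounded_on_posM => //; exact: bounded_on_pos_cst.
have [l Hl] : exists l : R, H t @[t --> +oo] --> l.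
  apply: (@nonincreasing_bounded_cvg _ H (fun t => - \sum_i d i * omega i t ^+ 2)
     (- (B * enorm Omega) - 2^-1 * \sum_i \sum_j a i j)) => //.
  - move=> t _; rewrite oppr_le0 sumr_ge0// => i _.
    by rewrite mulr_ge0 ?sqr_ge0// ltW.
  - move=> t t0; apply: le_trans (mech_energy_ge _ _ m0 a_ge0 Omega0).
    by rewrite lerD2r lerN2 ler_wpM2r ?enorm_ge0//; have [] := trap t t0.
have /cvgrPdist_le diss := barbalat dH dk kK Hl.
move=> i; apply/cvgrPdist_le => e e0.
have de0 : 0 < d i * e ^+ 2 by rewrite mulr_gt0 ?exprn_gt0.
near=> t.
have : `|0 - - \sum_i d i * omega i t ^+ 2| <= d i * e ^+ 2 by near: t; exact: diss.
rewrite !sub0r opprK normrN => /(le_trans (ler_norm _)).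
rewrite (bigD1 i)//= => le_e.
have {le_e} : d i * omega i t ^+ 2 <= d i * e ^+ 2.
  apply: le_trans le_e; rewrite lerDl sumr_ge0// => j _.
  by rewrite mulr_ge0 ?sqr_ge0// ltW.
rewrite ler_pM2l// -[omega i t ^+ 2]real_normK ?num_real//.
by rewrite ler_pXn2r// nnegrE// ltW.
Unshelve. all: by end_near. Qed.

(** The velocities converge and the accelerations have bounded derivatives, so a
    second use of [barbalat] makes the accelerations vanish; the net force is
    mass times acceleration plus friction. *)
Lemma net_force_cvg0 (R : realType) (N : nat) (m d Omega : 'I_N -> R)
    (a : 'M[R]_N) (theta omega : 'I_N -> R -> R) :
  (forall i, 0 < m i) ->
  kuramoto_solution m d Omega a theta omega ->
  (forall i, bounded_on_pos (omega i)) ->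
  (forall i, omega i t @[t --> +oo] --> 0) ->
  sqnorm (net_force Omega a (theta ^~ t)) @[t --> +oo] --> 0.
Proof.
move=> m0 sol om om0.
pose A i t := accel m d Omega a (theta ^~ t) (omega ^~ t) i.
pose k i t := (0 + (\sum_j a i j * (cos (theta j t - theta i t) * (omega j t -
  omega i t)))
   - d i * A i t) * (m i)^-1.
have A0 i : A i t @[t --> +oo] --> 0.
  have [K kK] : bounded_on_pos (k i).
    apply: bounded_on_posM; last exact: bounded_on_pos_cst.
    apply: bounded_on_posD; last first.
      apply: bounded_on_posN; apply: bounded_on_posM; first exact: bounded_on_pos_cst.
      exact: accel_bounded.
    apply: bounded_on_posD; first exact: bounded_on_pos_cst.
    apply: bounded_on_pos_sum => j; apply: bounded_on_posM; first exact:
      bounded_on_pos_cst.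
    apply: bounded_on_posM; first exact: bounded_on_pos_cos.
    by apply: bounded_on_posD => //; exact: bounded_on_posN.
  have dom (t : R) : 0 < t -> is_derive t 1 (omega i) (A i t).
    by move=> t0; have [] := solution_is_derive m0 sol t0 i.
  apply: (barbalat dom _ kK (om0 i)) => t t0.
  have dth j : is_derive t 1 (theta j) (omega j t).
    by have [] := solution_is_derive m0 sol t0 j.
  have dF : is_derive t 1 (fun s => net_force Omega a (theta ^~ s) i - d i * omega i s)
    (0 + (\sum_j a i j * (cos (theta j t - theta i t) * (omega j t - omega i t)))
   - d i * A i t).
    apply: is_derive_subf; last exact: is_derive_scalef (dom t t0).
    by apply: is_derive_addf; exact: coupling_is_derive.
  have := is_derive_scalef (m i)^-1 dF.
  rewrite /k mulrC; congr (is_derive _ _ _ _).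
  by apply/funext => s; rewrite /A /accel mulrC.
have F0 i : net_force Omega a (theta ^~ t) i @[t --> +oo] --> 0.
  have -> : (fun t => net_force Omega a (theta ^~ t) i) =
     (fun t => m i * A i t + d i * omega i t).
    apply/funext => t; rewrite /A /accel; have m_neq0 : m i != 0 by rewrite gt_eqF.
    by field.
  have : m i * A i t + d i * omega i t @[t --> +oo] --> m i * 0 + d i * 0.
    by apply: cvgD; apply: cvgMl_tmp; [exact: A0 | exact: om0].
  by rewrite !mulr0 addr0.
have -> : 0 = \sum_(i < N) 0 * 0 :> R by rewrite big1// => i _; rewrite mul0r.
by apply: cvg_sumf => i; apply: cvgM.
Qed.

Lemma cauchy_at_pinfty (R : realType) (f : R -> R) :
  (forall e : R, 0 < e -> exists T : R, forall s t, T < s -> T < t -> `|f s - f t|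
    < e) ->
  exists l : R, f t @[t --> +oo] --> l.
Proof.
move=> fC; suff /cauchy_cvgP/cvg_ex[l fl] : cauchy (f t @[t --> +oo]) by exists l.
apply: cauchy_exP => e e0; have [T fT] := fC e e0.
exists (f (T + 1)); exists T; split; first exact: num_real.
by move=> t /= Tt; apply: fT => //; lra.
Qed.

(** At late times the net force is at most [r]. The first bound on [r] brings the
    spread below [D0 / 2], the second then makes the phase differences at any
    two such times [e]-close. *)
Lemma phase_locking (R : realType) (N : nat) (m d Omega : 'I_N -> R)
    (a : 'M[R]_N) (D0 : R) (theta omega : 'I_N -> R -> R) :
  (forall i, 0 < m i) -> (forall i, 0 < d i) ->
  (forall i j, a i j = a j i) -> (forall i j, 0 <= a i j) -> \sum_i Omega i = 0 ->
  graph_connected a -> 0 < a_l a -> 0 < D0 -> D0 < pi -> (0 < N)%N ->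
  0 < stiffness a (R_0 D0) ->
  6 * enorm Omega <= stiffness a (R_0 D0) * D0 ->
  kuramoto_solution m d Omega a theta omega ->
  (forall t : R, 0 < t ->
    enorm (fluct (theta ^~ t)) <= D0 / 2 /\ enorm (omega ^~ t) <= D0 / 2) ->
  phase_locked theta.
Proof.
move=> m0 d0 a_sym a_ge0 Omega0 conn al0 D0_gt0 D0_pi N0 G0 Omega_le sol trap i j _.
have om i0 : bounded_on_pos (omega i0).
  exists (D0 / 2) => t t0; have [_] := trap t t0.
  exact: le_trans (normr_le_enorm (omega ^~ t) i0).
have := net_force_cvg0 m0 sol om (velocity_cvg0 m0 d0 a_sym a_ge0 Omega0 sol trap).
move=> /cvgrPdist_le F0; apply: cauchy_at_pinfty => e e0.
have c0 : 0 < cos (D0 / 2) by apply: cos_gt0_pihalf; have := pi_gt0 R; lra.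
have k0 : 0 < stiffness a (cos (D0 / 2)).
  by rewrite /stiffness; do 3?[apply: mulr_gt0 => //]; rewrite ?L_star_gt0 ?ltr0n.
set G := stiffness a (R_0 D0) in G0 Omega_le.
set k := stiffness a (cos (D0 / 2)) in k0.
pose r := Num.min (G * D0 / 12) (k * e / 6).
have r0 : 0 < r.
  by rewrite lt_min; apply/andP; split; apply: divr_gt0 => //; exact: mulr_gt0.
have r_G : r <= G * D0 / 12 by rewrite ge_min lexx.
have r_k : r <= k * e / 6 by rewrite ge_min lexx orbT.
have [T [_ FT]] := F0 (r ^+ 2) (exprn_gt0 2 r0).
have F_le t : Num.max T 0 < t -> enorm (net_force Omega a (theta ^~ t)) <= r.
  rewrite gt_max => /andP[Tt _]; apply: enorm_le; first exact: ltW.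
  by have := FT t Tt; rewrite /= sub0r normrN; exact: le_trans (ler_norm _).
have diam_le t : Num.max T 0 < t -> forall p q, `|theta p t - theta q t| <= D0 / 2.
  move=> Tt p q; have t0 : 0 < t by move: Tt; rewrite gt_max => /andP[].
  have xD p0 q0 : `|theta p0 t - theta q0 t| <= D0.
    by have := dist_le_enorm_fluct (theta ^~ t) p0 q0; have [] := trap t t0; lra.
  have := @fluct_le_force _ _ a Omega D0 (theta ^~ t) a_sym a_ge0 conn (ltW al0)
    D0_gt0 D0_pi xD.
  have := F_le t Tt => Fr /le_trans/(_ (lerD (lexx _) Fr)); rewrite -/G => Gy.
  have y_le : enorm (fluct (theta ^~ t)) <= D0 / 4 by rewrite -(ler_pM2l G0); lra.
  by have := dist_le_enorm_fluct (theta ^~ t) p q; lra.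
exists (Num.max T 0) => s t Ts Tt.
have := @fluct_dist_le_force _ _ a Omega (D0 / 2) (theta ^~ s) (theta ^~ t) a_sym
  a_ge0 conn
  (ltW al0) _ _ (diam_le s Ts) (diam_le t Tt).
move=> /(_ ltac:(lra) ltac:(lra)); rewrite -/k.
set z := fun i => _; have := dist_le_enorm_fluct z i j.
have -> : z i - z j = theta i s - theta j s - (theta i t - theta j t) by rewrite
  /z; ring.
have := F_le s Ts; have := F_le t Tt => h1 h2 h3 h4.
have z_le : enorm (fluct z) <= e / 3 by rewrite -(ler_pM2l k0); lra.
lra.
Qed.

Unset Implicit Arguments.

Theorem theorem2p1 (R : realType) (N : nat) (N_gt0 : (0 < N)%N)
    (m d Omega : 'I_N -> R) (a : 'M[R]_N)
    (m_gt0 : forall i, 0 < m i) (d_gt0 : forall i, 0 < d i)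
    (a_ge0 : forall i j, 0 <= a i j) (a_sym : forall i j, a i j = a j i)
    (Omega_sum0 : \sum_i Omega i = 0)
    (D0 : R) (D0_gt0 : 0 < D0) (D0_ltpi : D0 < pi)
    (theta omega : 'I_N -> R -> R)
    (sol : kuramoto_solution m d Omega a theta omega)
    (H1 : graph_connected a)
    (H2 : a_u a ^+ 2 * N%:R ^+ 2 * (2 * max_param m + lambda m d) <
          min_param d ^+ 2 *
            (2 * R_0 D0 * a_l a * L_star a * N%:R - lambda m d))
    (H3 : exists eps : R,
       [/\ a_u a ^+ 2 * N%:R ^+ 2 /
             (min_param d *
               (2 * R_0 D0 * a_l a * L_star a * N%:R - lambda m d)) < eps,
           eps < min_param d / (2 * max_param m + lambda m d) &
           Num.max
             (Num.sqrt (energy0 m d eps (theta ^~ 0) (omega ^~ 0)))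
             (2 * Num.sqrt 2 * C_1 m d eps * Num.max eps 1 * enorm Omega /
               (C_l_tilde m d a D0 eps * Num.sqrt (C_0 m d eps)))
           < Num.sqrt (C_0 m d eps) / 2 * D0]) :
  phase_locked theta.
Proof.
have [eps [eps_gt eps_lt E_Omega]] := H3.
have [[al0 e0 C0 Cl] [G0 E_lt Omega_lt Omega_le]] :=
  parameter_bounds N_gt0 m_gt0 d_gt0 D0_gt0 D0_ltpi H2 eps_gt eps_lt E_Omega.
apply: (phase_locking m_gt0 d_gt0 a_sym a_ge0 Omega_sum0 H1 al0 D0_gt0 D0_ltpi
  N_gt0 G0 Omega_le sol).
exact: energy_trapping N_gt0 m_gt0 d_gt0 a_sym a_ge0 H1 (ltW al0) D0_gt0 D0_ltpi e0
  C0 Cl Omega_lt E_lt sol.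
Qed.
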